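(* Let $G$ be a CAT(0) group, i.e. a group acting properly and cocompactly by isometries on a CAT(0) space $Y$, and let $H=\langle g\rangle\leq G$ be a cyclic subgroup generated by an element $g\in G$ that acts on $Y$ as a rank-$1$ isometry. Then $H$ has bounded packing in $G$.
   Context: Bounded packing: let $G$ be a countable group with a proper, left-invariant metric $d$ (proper means that balls of finite radius are finite), and let $H\leq G$. For subsets $S,T\subset G$ put $d(S,T)=\inf\{d(s,t): s\in S,\ t\in T\}$. The subgroup $H$ has bounded packing in $G$ if for every $D>0$ there is a number $n=n(G,H,D)$ such that every collection $I\subset G/H$ of left cosets of $H$ with $d(g_1H,g_2H)\leq D$ for all $g_1H,g_2H\in I$ satisfies $|I|\leq n$. This property does not depend on the choice of the proper left-invariant metric $d$; every countable group admits such a metric, e.g. a word metric if the group is finitely generated. Rank-$1$ isometry: an isometry $g$ of a CAT(0) space $Y$ is rank-$1$ if it is axial (hyperbolic), i.e. it translates some geodesic line in $Y$ (an axis) by a positive amount, and it has an axis that does not bound a flat half-plane in $Y$ (a flat half-plane is an isometrically embedded copy of a closed Euclidean half-plane). *)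

(* Defs.v *)
From mathcomp Require Import all_boot all_order all_algebra.
From mathcomp Require Import all_classical all_reals all_analysis.

Set Implicit Arguments.
Unset Strict Implicit.
Unset Printing Implicit Defensive.

Import Order.TTheory GRing.Theory Num.Theory.
Import numFieldNormedType.Exports.

Local Open Scope classical_set_scope.
Local Open Scope card_scope.
Local Open Scope ring_scope.

(** * Geodesics and CAT(0) spaces *)

(* The norm that the library puts on R * R is the sup norm, so the Euclidean
   distance of the plane is written out here. *)
Definition edist (R : realType) (p q : R * R) : R :=
  Num.sqrt ((p.1 - q.1) ^+ 2 + (p.2 - q.2) ^+ 2).

Definition isometry_on (R : realType) (S T : Type) (dS : S -> S -> R)
    (dT : T -> T -> R) (A : set S) (f : S -> T) : Prop :=
  forall s t, A s -> A t -> dT (f s) (f t) = dS s t.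

Definition rdist (R : realType) (s t : R) : R := `|s - t|.

(* Geodesics are parametrised by arc length on [0, dist x y]; the values of c
   outside this interval are irrelevant.  The distance function is a parameter
   because the notion is used both in Y and in the Euclidean plane. *)
Definition geodesic (R : realType) (T : Type) (dist : T -> T -> R)
    (x y : T) (c : R -> T) : Prop :=
  [/\ c 0 = x, c (dist x y) = y &
      isometry_on (@rdist R) dist [set t | 0 <= t <= dist x y] c].

Definition geodesic_space (R : realType) (Y : metricType R) : Prop :=
  forall x y : Y, exists c, geodesic (@mdist R Y) x y c.

Definition geodesic_triangle (R : realType) (T : Type) (dist : T -> T -> R)
    (p q r : T) (a b c : R -> T) : Prop :=
  [/\ geodesic dist p q a, geodesic dist q r b & geodesic dist r p c].

(* x lies on the side a of length l and x' is the point of the corresponding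
   side a' of a comparison triangle at the same distance from its origin. *)
Definition side_comparison (R : realType) (T : Type) (l : R)
    (a : R -> T) (a' : R -> R * R) (x : T) (x' : R * R) : Prop :=
  exists t, [/\ 0 <= t <= l, x = a t & x' = a' t].

Definition CAT0 (R : realType) (Y : metricType R) : Prop :=
  geodesic_space Y /\
  forall (p q r : Y) (a b c : R -> Y) (p' q' r' : R * R) (a' b' c' : R -> R * R),
    geodesic_triangle (@mdist R Y) p q r a b c ->
    geodesic_triangle (@edist R) p' q' r' a' b' c' ->
    edist p' q' = mdist p q -> edist q' r' = mdist q r ->
    edist r' p' = mdist r p ->
    let comparison_point x x' :=
      [\/ side_comparison (mdist p q) a a' x x',
          side_comparison (mdist q r) b b' x x' |
          side_comparison (mdist r p) c c' x x'] in
    forall (x y : Y) (x' y' : R * R),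
      comparison_point x x' -> comparison_point y y' ->
      mdist x y <= edist x' y'.

(** * Group actions *)

Record isometric_action (R : realType) (G : groupType) (Y : metricType R)
    (act : G -> Y -> Y) : Prop := IsometricAction {
  act_one : forall y, act 1%g y = y ;
  act_mul : forall g h y, act (g * h)%g y = act g (act h y) ;
  act_isometry : forall g x y, mdist (act g x) (act g y) = mdist x y
}.

(* Properness in the sense of Bridson and Haefliger. *)
Definition proper_action (R : realType) (G : groupType) (Y : metricType R)
    (act : G -> Y -> Y) : Prop :=
  forall x : Y, exists2 r : R, 0 < r &
    finite_set [set g : G | (act g @` ball x r) `&` ball x r !=set0].

Definition cocompact_action (R : realType) (G : groupType) (Y : metricType R)
    (act : G -> Y -> Y) : Prop :=
  exists2 K : set Y, compact K & \bigcup_(g in [set: G]) (act g @` K) = setT.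

(** * Rank-1 isometries *)

Definition geodesic_line (R : realType) (Y : metricType R) (l : R -> Y) : Prop :=
  isometry_on (@rdist R) (@mdist R Y) setT l.

Definition is_axis (R : realType) (Y : metricType R) (f : Y -> Y)
    (l : R -> Y) : Prop :=
  geodesic_line l /\ exists2 tau : R, 0 < tau & forall t, f (l t) = l (t + tau).

Definition bounds_flat_half_plane (R : realType) (Y : metricType R)
    (l : R -> Y) : Prop :=
  exists2 h : R * R -> Y,
    isometry_on (@edist R) (@mdist R Y) [set p | 0 <= p.2] h &
    h @` [set p | p.2 = 0] = range l.

Definition rank_one (R : realType) (Y : metricType R) (f : Y -> Y) : Prop :=
  exists2 l : R -> Y, is_axis f l & ~ bounds_flat_half_plane l.

(** * Bounded packing *)

Definition cyclic_subgroup (G : groupType) (g : G) : set G :=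
  [set x | exists n : nat, x = (g ^+ n)%g \/ x = (g ^- n)%g].

Definition left_cosets (G : groupType) (H : set G) : set (set G) :=
  [set [set (g * h)%g | h in H] | g in [set: G]].

Record proper_left_invariant_metric (R : realType) (G : groupType)
    (d : G -> G -> R) : Prop := ProperLeftInvariantMetric {
  plim_ge0 : forall x y, 0 <= d x y ;
  plim_eq0 : forall x y, d x y = 0 <-> x = y ;
  plim_sym : forall x y, d x y = d y x ;
  plim_triangle : forall x y z, d x z <= d x y + d y z ;
  plim_left_invariant : forall g x y, d (g * x)%g (g * y)%g = d x y ;
  plim_proper : forall x r, finite_set [set y | d x y <= r]
}.

Definition set_dist (R : realType) (G : Type) (d : G -> G -> R)
    (S T : set G) : R :=
  inf [set d s t | s in S & t in T].

Definition bounded_packing_for (R : realType) (G : groupType) (d : G -> G -> R)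
    (H : set G) : Prop :=
  forall D : R, 0 < D -> exists n : nat,
    forall I : set (set G), I `<=` left_cosets H ->
      (forall A B, I A -> I B -> set_dist d A B <= D) ->
      I #<= `I_n.

(* Bounded packing does not depend on the choice of d, hence the universal
   quantifier.  The first conjunct rules out vacuity: a group carries a proper
   left-invariant metric exactly when it is countable. *)
Definition bounded_packing (R : realType) (G : groupType) (H : set G) : Prop :=
  (exists d : G -> G -> R, proper_left_invariant_metric d) /\
  (forall d : G -> G -> R, proper_left_invariant_metric d ->
     bounded_packing_for d H).

(* Main.v *)
Require Import Defs.
From HB Require Import structures.
From mathcomp Require Import all_boot all_order all_algebra.
From mathcomp Require Import all_classical all_reals all_analysis.
From mathcomp Require Import ring lra.
Import Defs.

(** Translates of a rank-1 axis l that are pairwise close all pass through one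
    ball of uniform radius; since the action is proper, only boundedly many
    cosets have a translate through a given ball.

    Nonpositive curvature enters through the CN inequality.  Describe a point
    by the parameter of its projection on l, its foot, and its distance to l,
    its height.  The map to these coordinates does not increase distances
    (foot_height_nonexpanding).

    The absence of a flat half-plane is exploited through compactness
    (expansion): there are S0, L and e > 0 such that two points at height S0
    whose feet are L apart are at distance at least L + e.  Otherwise ever
    larger and ever flatter rectangles standing on l would, after translation
    along l, converge to a flat half-plane.  By convexity of the distance the
    gain e grows linearly with the height (expanding_dist), so a geodesic that
    stays high above l has a foot that moves much more slowly than the geodesic
    itself (slow_drift_exists).

    Consider now a family of translates of l that are pairwise within C, and a
    point z whose greatest distance N to them is almost minimal.  If N is large,
    project z to the farthest line.  A geodesic from z to another line, followed
    by that line until it comes close to the first one, is high above the first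
    line except in the second half of the geodesic, whose length is at most
    N / 2; so its foot moves by at most about 3 / 4 N.  Hence
    the projection of z has distance less than N - 1 to all the lines
    (lines_approach), a contradiction: N is bounded by a constant
    (common_point).

    Properness and cocompactness give that balls of Y lie in compact sets and
    that orbits are locally finite.  The second fact bounds the number of cosets
    whose line passes near a point, and yields a proper left-invariant metric
    on G from the metric of an orbit. *)

Set Implicit Arguments.
Unset Strict Implicit.
Unset Printing Implicit Defensive.

Import Order.TTheory GRing.Theory Num.Theory.
Import numFieldNormedType.Exports.

Local Open Scope classical_set_scope.
Local Open Scope ring_scope.

(** * From comparison triangles to the CN inequality *)

(** Most of the argument sees a geodesic only through the points that divide it
    in a given ratio, which makes parametrisations unnecessary there. *)
Definition at_fraction (R : realType) (Y : metricType R) (x y : Y) (t : R)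
    (m : Y) : Prop :=
  mdist x m = t * mdist x y /\ mdist m y = (1 - t) * mdist x y.

(** Stewart's theorem, an equality in the plane, read as an upper bound: the
    Bruhat-Tits form of nonpositive curvature. *)
Definition CN_space (R : realType) (Y : metricType R) : Prop :=
  geodesic_space Y /\
  forall (x y z m : Y) (t : R), 0 <= t <= 1 -> at_fraction x y t m ->
    mdist z m ^+ 2 <= (1 - t) * mdist z x ^+ 2 + t * mdist z y ^+ 2
                      - t * (1 - t) * mdist x y ^+ 2.

Definition plane_segment (R : realType) (p q : R * R) (t : R) : R * R :=
  let u := t / edist p q in
  (p.1 + u * (q.1 - p.1), p.2 + u * (q.2 - p.2)).

Lemma edist_sqr (R : realType) (p q : R * R) :
  edist p q ^+ 2 = (p.1 - q.1) ^+ 2 + (p.2 - q.2) ^+ 2.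
Proof. by rewrite sqr_sqrtr // addr_ge0 // sqr_ge0. Qed.

Lemma edist_ge0 (R : realType) (p q : R * R) : 0 <= edist p q.
Proof. exact: sqrtr_ge0. Qed.

Lemma edist_eq (R : realType) (p q : R * R) (d : R) :
  0 <= d -> (p.1 - q.1) ^+ 2 + (p.2 - q.2) ^+ 2 = d ^+ 2 -> edist p q = d.
Proof. by move=> d0 e; rewrite /edist e sqrtr_sqr ger0_norm. Qed.

Lemma plane_segment_geodesic (R : realType) (p q : R * R) :
  geodesic (@edist R) p q (plane_segment p q).
Proof.
have [pq0|pqN0] := eqVneq (edist p q) 0.
  have := edist_sqr p q; rewrite pq0 expr0n /= => /esym/eqP.
  rewrite paddr_eq0 ?sqr_ge0 // !sqrf_eq0 !subr_eq0 => /andP[/eqP e1 /eqP e2].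
  have epq : p = q by case: p q e1 e2 {pq0} => ? ? [? ?] /= -> ->.
  split; rewrite /plane_segment ?pq0 /=.
  - by rewrite mul0r !mul0r !addr0; case: (p).
  - by rewrite mul0r !mul0r !addr0 -epq; case: (p).
  - move=> s t /= ; rewrite -eq_le => /eqP <-; rewrite -eq_le => /eqP <-.
    by rewrite /rdist subrr normr0; apply: edist_eq => //=; ring.
split; rewrite /plane_segment /=.
- by rewrite mul0r !mul0r !addr0; case: (p).
- by rewrite divff // !mul1r; case: (q) => a b /=; congr pair; lra.
- move=> s t _ _; apply: edist_eq => /=; first by rewrite normr_ge0.
  rewrite /rdist real_normK ?num_real //.
  have -> : (p.1 + s / edist p q * (q.1 - p.1)
     - (p.1 + t / edist p q * (q.1 - p.1))) ^+ 2 +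
    (p.2 + s / edist p q * (q.2 - p.2)
     - (p.2 + t / edist p q * (q.2 - p.2))) ^+ 2
   = ((s - t) / edist p q) ^+ 2 * ((p.1 - q.1) ^+ 2 + (p.2 - q.2) ^+ 2).
    by ring.
  by rewrite -edist_sqr -exprMn divfK.
Qed.

(** The first two vertices lie on the horizontal axis; the law of cosines then
    determines the abscissa u of the third, and the triangle inequalities say
    that its squared ordinate is nonnegative. *)
Lemma comparison_triangle (R : realType) (a b c : R) :
  0 <= a -> 0 <= b -> 0 <= c -> a <= b + c -> b <= c + a -> c <= a + b ->
  exists p q r : R * R, [/\ edist p q = a, edist q r = b & edist r p = c].
Proof.
move=> a0 b0 c0 abc bca cab; have [ae|aN0] := eqVneq a 0.
  subst a; have -> : b = c by lra.
  exists (0, 0), (0, 0), (c, 0); split; apply: edist_eq => //=; ring.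
have apos : 0 < a by rewrite lt_neqAle eq_sym aN0.
pose u := (a ^+ 2 + c ^+ 2 - b ^+ 2) / (2 * a).
have uE : 2 * a * u = a ^+ 2 + c ^+ 2 - b ^+ 2.
  by rewrite /u mulrC divfK // mulf_neq0 // pnatr_eq0.
have cu : 0 <= c ^+ 2 - u ^+ 2.
  have h1 : 0 <= a * (c - u).
    have : 0 <= (b - (a - c)) * (b + (a - c)) by apply: mulr_ge0; lra.
    by move=> h; nra.
  have h2 : 0 <= a * (c + u).
    have : 0 <= ((a + c) - b) * ((a + c) + b) by apply: mulr_ge0; lra.
    by move=> h; nra.
  rewrite pmulr_rge0 // in h1; rewrite pmulr_rge0 // in h2.
  by rewrite subr_sqr mulr_ge0.
exists (0, 0), (a, 0), (u, Num.sqrt (c ^+ 2 - u ^+ 2)).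
have sE := sqr_sqrtr cu.
set v := Num.sqrt _ in sE *.
by split; apply: edist_eq => //=; nra.
Qed.

(** Comparing the vertex z with the point m of the opposite side bounds
    mdist z m by its counterpart in the comparison triangle, which Stewart's
    theorem computes.  The inequality also makes m unique, so a point that only
    satisfies the two distance equations does lie on the given geodesic. *)
Lemma CAT0_CN (R : realType) (Y : metricType R) : CAT0 Y -> CN_space Y.
Proof.
case=> geoY cmp; split=> //.
have main (x y z : Y) (t : R) (a : R -> Y) : 0 <= t <= 1 ->
    geodesic (@mdist R Y) x y a ->
    mdist z (a (t * mdist x y)) ^+ 2 <= (1 - t) * mdist z x ^+ 2
       + t * mdist z y ^+ 2 - t * (1 - t) * mdist x y ^+ 2.
  move=> t01 ga; have [t0 t1] := andP t01.
  have [b gb] := geoY y z; have [c gc] := geoY z x.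
  have [||||||p [q [r [epq eqr erp]]]] :=
    @comparison_triangle R (mdist x y) (mdist y z) (mdist z x);
    rewrite ?mdist_ge0 //.
  - have := metric_triangle x z y.
    by rewrite (metric_sym x z) (metric_sym z y) addrC.
  - have := metric_triangle y x z.
    by rewrite (metric_sym y x) (metric_sym x z) addrC.
  - by have := metric_triangle x y z; rewrite (metric_sym x z).
  set d := mdist x y in epq *.
  have d0 : 0 <= d by apply: mdist_ge0.
  have := @cmp x y z a b c p q r (plane_segment p q) (plane_segment q r)
    (plane_segment r p).
  have [ga0 ga1 _] := ga.
  move=> /(_ _ _ epq eqr erp) /= H.
  have {}H := H (And3 ga gb gc) (And3 (plane_segment_geodesic p q)
    (plane_segment_geodesic q r) (plane_segment_geodesic r p))
    z (a (t * d)) r (plane_segment p q (t * d)).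
  have {}H : mdist z (a (t * d)) <= edist r (plane_segment p q (t * d)).
    apply: H.
      apply: Or33; exists 0; have [gc0 gc1 _] := gc; split=> //.
        by rewrite lexx mdist_ge0.
      by have [-> _ _] := plane_segment_geodesic r p.
    by apply: Or31; exists (t * d); split => //; rewrite mulr_ge0 //= ler_piMl.
  have : mdist z (a (t * d)) ^+ 2 <= edist r (plane_segment p q (t * d)) ^+ 2.
    by rewrite ler_sqr ?nnegrE ?mdist_ge0 ?edist_ge0.
  move=> /le_trans; apply.
  rewrite -erp (metric_sym z y) -eqr -epq !edist_sqr /plane_segment /= epq.
  have [de|dN] := eqVneq d 0.
    have := edist_sqr p q; rewrite epq de expr0n /= => /esym/eqP.
    rewrite paddr_eq0 ?sqr_ge0 // !sqrf_eq0 !subr_eq0 => /andP[/eqP e1 /eqP e2].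
    by rewrite e1 e2 !subrr !mulr0 !addr0; nra.
  rewrite mulfK // le_eqVlt; apply/orP; left; apply/eqP.
  by ring.
move=> x y z m t t01 [xm my].
have [a ga] := geoY x y.
(* Applied to z = m the inequality has right-hand side 0. *)
suff -> : m = a (t * mdist x y) by exact: main.
apply/mdist_positivity/eqP; rewrite -sqrf_eq0 eq_le sqr_ge0 andbT.
apply: le_trans (main x y m t a t01 ga) _.
by rewrite (metric_sym m x) xm my; nra.
Qed.

(** * Quadrilaterals and convexity of the distance *)

Section CNGeometry.
Variables (R : realType) (Y : metricType R).
Hypothesis cnY : CN_space Y.

Lemma at_fraction_exists (x y : Y) (t : R) :
  0 <= t <= 1 -> exists m, at_fraction x y t m.
Proof.
case: cnY => /(_ x y)[c [c0 c1 iso]] _ /andP[t0 t1].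
have d0 := mdist_ge0 x y.
have in0 : 0 <= t * mdist x y <= mdist x y by rewrite mulr_ge0 //= ler_piMl.
exists (c (t * mdist x y)); split.
  by rewrite -{1}c0 iso /= ?lexx ?d0 // /rdist sub0r normrN ger0_norm // mulr_ge0.
rewrite -{2}c1 iso /= ?lexx ?d0 // /rdist distrC ger0_norm; first by ring.
by have := andP in0 => -[_ h]; rewrite subr_ge0.
Qed.

Lemma at_fraction_sym (x y m : Y) (t : R) :
  at_fraction x y t m -> at_fraction y x (1 - t) m.
Proof.
move=> [xm my]; split; first by rewrite metric_sym my (metric_sym x).
by rewrite metric_sym xm (metric_sym x) opprB addrC subrK.
Qed.

Lemma ge0_sqr_le (a b : R) : 0 <= b -> a ^+ 2 <= b ^+ 2 -> a <= b.
Proof.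
move=> b0 h; apply: le_trans (ler_norm a) _.
by rewrite -(ger0_norm b0) -ler_sqr ?nnegrE // !real_normK ?num_real.
Qed.

(** Two uses of the CN inequality, on a b and on a b', in whose sum all terms
    except the one in mdist b b' cancel. *)
Lemma triangle_scaling (a b b' m m' : Y) (t : R) : 0 <= t <= 1 ->
  at_fraction a b t m -> at_fraction a b' t m' -> mdist m m' <= t * mdist b b'.
Proof.
move=> t01 fm fm'; have [t0 t1] := andP t01; have [_ cn] := cnY.
apply: ge0_sqr_le; first by rewrite mulr_ge0 // mdist_ge0.
have h1 := cn a b m' m t t01 fm.
have h2 := cn a b' b m' t t01 fm'.
rewrite (metric_sym m m'); apply: le_trans h1 _.
have [am' _] := fm'.
rewrite (metric_sym m' a) am' (metric_sym m' b).
rewrite (metric_sym b a) in h2.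
have := mdist_ge0 b b'.
move: (mdist b m') (mdist a b) (mdist a b') (mdist b b') h2 => u v w z h2 _.
have h3 := ler_wpM2l t0 h2; nra.
Qed.

(** Cut the quadrilateral along the diagonal from a to b'. *)
Lemma distance_convex (a b a' b' m m' : Y) (t : R) : 0 <= t <= 1 ->
  at_fraction a b t m -> at_fraction a' b' t m' ->
  mdist m m' <= (1 - t) * mdist a a' + t * mdist b b'.
Proof.
move=> t01 fm fm'; have [t0 t1] := andP t01.
have [n fn] := at_fraction_exists a b' t01.
apply: le_trans (metric_triangle m n m') _.
rewrite addrC lerD //; last exact: triangle_scaling fm fn.
apply: triangle_scaling (at_fraction_sym fn) (at_fraction_sym fm').
by rewrite subr_ge0 t1 /= gerBl.
Qed.

(** Reshetnyak's inequality for the diagonals of a quadrilateral, with a free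
    weight t.  The point m at fraction t of the diagonal x2 x4 is compared with
    x1 and x3, and the triangle inequality for x1, m, x3 is squared with the
    weights 1 / t and 1 / (1 - t).  The best t turns the last two terms into
    twice the product of the opposite sides x1 x2 and x3 x4. *)
Lemma quadrilateral (x1 x2 x3 x4 : Y) (t : R) : 0 < t < 1 ->
  mdist x1 x3 ^+ 2 + mdist x2 x4 ^+ 2 <=
    mdist x1 x4 ^+ 2 + mdist x2 x3 ^+ 2
    + (1 - t) / t * mdist x1 x2 ^+ 2 + t / (1 - t) * mdist x3 x4 ^+ 2.
Proof.
move=> /andP[t0 t1]; have t01 : 0 <= t <= 1 by rewrite !ltW.
have [m fm] := at_fraction_exists x2 x4 t01.
have [_ cn] := cnY.
have h1 := cn x2 x4 x1 m t t01 fm.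
have h3 := cn x2 x4 x3 m t t01 fm.
have tri := metric_triangle x1 m x3.
rewrite (metric_sym x3 m) (metric_sym x3 x2) in h3.
have t1' : 0 < 1 - t by rewrite subr_gt0.
have d0 := mdist_ge0 x1 x3.
have tri2 : mdist x1 x3 ^+ 2 <= (mdist x1 m + mdist m x3) ^+ 2.
  by rewrite ler_sqr ?nnegrE ?addr_ge0 ?mdist_ge0.
have tri3 : (mdist x1 m + mdist m x3) ^+ 2 <=
  mdist x1 m ^+ 2 / t + mdist m x3 ^+ 2 / (1 - t).
  rewrite -subr_ge0.
  have -> : mdist x1 m ^+ 2 / t + mdist m x3 ^+ 2 / (1 - t) -
    (mdist x1 m + mdist m x3) ^+ 2 =
    ((1 - t) * mdist x1 m - t * mdist m x3) ^+ 2 / (t * (1 - t)).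
    by field; rewrite ?gt_eqF.
  by rewrite divr_ge0 ?sqr_ge0 // mulr_ge0 // ltW.
have h1' : mdist x1 m ^+ 2 / t <= (1 - t) / t * mdist x1 x2 ^+ 2
   + mdist x1 x4 ^+ 2 - (1 - t) * mdist x2 x4 ^+ 2.
  rewrite ler_pdivrMr //; apply: le_trans h1 _.
  rewrite le_eqVlt; apply/orP; left; apply/eqP; by field; rewrite ?gt_eqF.
have h3' : mdist m x3 ^+ 2 / (1 - t) <= mdist x2 x3 ^+ 2
   + t / (1 - t) * mdist x3 x4 ^+ 2 - t * mdist x2 x4 ^+ 2.
  rewrite ler_pdivrMr //; apply: le_trans h3 _.
  rewrite le_eqVlt; apply/orP; left; apply/eqP; by field; rewrite ?gt_eqF.
apply: le_trans (lerD tri2 (lexx _)) _.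
apply: le_trans (lerD tri3 (lexx _)) _.
apply: le_trans (lerD (lerD h1' h3') (lexx _)) _.
rewrite le_eqVlt; apply/orP; left; apply/eqP; ring.
Qed.

End CNGeometry.

(** * Foot and height over a geodesic line *)

Lemma lipschitz_continuous (R : realType) (f : R -> R) :
  (forall s t, `|f s - f t| <= `|s - t|) -> continuous f.
Proof.
move=> lip t; apply/cvgrPdist_le => e e0; near=> s.
apply: le_trans (lip _ _) _; near: s.
exact: (@cvgr_dist_le _ _ _ (nbhs t) _ id t).
Unshelve. all: by end_near. Qed.

(** Precomposing with the retraction onto the segment makes f Lipschitz on the
    whole line. *)
Lemma lipschitz_within_continuous (R : realType) (f : R -> R) (a b : R) :
  a <= b ->
  (forall s t, a <= s <= b -> a <= t <= b -> `|f s - f t| <= `|s - t|) ->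
  {within `[a, b], continuous f}.
Proof.
move=> ab lip; pose clamp (t : R) := Num.max a (Num.min t b).
have clamp_in t : a <= clamp t <= b.
  by rewrite /clamp le_max lexx ge_max ab ge_min lexx orbT.
have clamp_id t : a <= t <= b -> clamp t = t.
  by move=> /andP[? ?]; rewrite /clamp min_l // max_r.
apply: (@subspace_eq_continuous _ _ _ (f \o clamp)).
  move=> t; rewrite inE /= in_itv /= => tab; congr f; exact: clamp_id.
apply: continuous_subspaceT; apply: lipschitz_continuous => s t /=.
apply: le_trans (lip _ _ (clamp_in s) (clamp_in t)) _.
have contr u v : u <= v -> 0 <= clamp v - clamp u <= v - u.
  rewrite /clamp => uv; case: (leP u b) => ?; case: (leP v b) => ?;
  case: (leP a u) => ?; case: (leP a v) => ?; case: (leP a b) => ?; lra.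
case: (leP s t) => st.
  have /andP[h1 h2] := contr _ _ st.
  by rewrite distrC (distrC s) !ger0_norm // subr_ge0.
have /andP[h1 h2] := contr _ _ (ltW st).
by rewrite !ger0_norm // subr_ge0 ltW.
Qed.

(** A geodesic line serves as a coordinate axis: foot is the parameter of the
    nearest point projection and height the distance to the line. *)
Definition foot_at (R : realType) (Y : metricType R) (l : R -> Y) (x : Y)
    (t : R) : Prop :=
  forall s, mdist x (l t) <= mdist x (l s).

Definition foot (R : realType) (Y : metricType R) (l : R -> Y) (x : Y) : R :=
  xget 0 (foot_at l x).

Definition height (R : realType) (Y : metricType R) (l : R -> Y) (x : Y) : R :=
  mdist x (l (foot l x)).

Section Foot.
Variables (R : realType) (Y : metricType R) (l : R -> Y).
Hypothesis cnY : CN_space Y.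
Hypothesis line_l : geodesic_line l.

Lemma lineE (s t : R) : mdist (l s) (l t) = `|s - t|.
Proof. by rewrite line_l. Qed.

Lemma dist_lip (x y z : Y) : `|mdist x z - mdist y z| <= mdist x y.
Proof.
have h1 := metric_triangle x y z; have h2 := metric_triangle y x z.
by rewrite (metric_sym y x) in h2; rewrite ler_norml; lra.
Qed.

Lemma foot_at_exists (x : Y) : exists t, foot_at l x t.
Proof.
pose f t := mdist x (l t); pose r := 2 * f 0.
have r0 : 0 <= r by rewrite mulr_ge0 // mdist_ge0.
have cf : {within `[- r, r], continuous f}.
  apply: lipschitz_within_continuous => [|s t _ _]; first lra.
  by rewrite -(lineE s t) /f (metric_sym x) (metric_sym x (l t)); exact: dist_lip.
have [|c _ cmin] := EVT_min _ cf; first lra.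
exists c => s; case: (boolP (s \in `[- r, r])) => [/cmin//|].
rewrite in_itv /= => sr; have := cmin 0; rewrite in_itv /= oppr_le0 r0 => /(_ isT).
rewrite -/(f c) -/(f s) => h; apply: le_trans h _.
have : r < `|s - 0|.
  rewrite subr0; move: sr; rewrite negb_and -!ltNge => /orP[sr|/lt_le_trans]; last first.
    by apply; exact: ler_norm.
  by rewrite -normrN; apply: lt_le_trans (ler_norm _); lra.
rewrite -lineE; have := metric_triangle (l s) x (l 0).
by rewrite (metric_sym (l s) x) /r /f; lra.
Qed.

Lemma footP (x : Y) : foot_at l x (foot l x).
Proof. by have [t ht] := foot_at_exists x; apply: (xgetPex 0); exists t. Qed.

Lemma line_at_fraction (s t u : R) : 0 <= u <= 1 ->
  at_fraction (l s) (l t) u (l (s + u * (t - s))).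
Proof.
move=> /andP[u0 u1]; split; rewrite !lineE.
  by rewrite opprD addrA subrr sub0r normrN normrM (ger0_norm u0) distrC.
have -> : s + u * (t - s) - t = (1 - u) * (s - t) by ring.
by rewrite normrM ger0_norm // subr_ge0.
Qed.

(** The angle at the foot is at least a right angle.  A point of the line near
    l p, at fraction u of the way to l t, is not closer to x than l p; the CN
    inequality at that point gives the claim as u tends to 0. *)
Lemma foot_at_pythagoras (x : Y) (p t : R) : foot_at l x p ->
  mdist x (l p) ^+ 2 + (t - p) ^+ 2 <= mdist x (l t) ^+ 2.
Proof.
move=> fp; rewrite -lerBrDl; apply/ler_addgt0Pl => e e0.
set D := (t - p) ^+ 2; have D0 : 0 <= D by exact: sqr_ge0.
(* Any u of (0, 1] with u * D <= e would do. *)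
pose u := e / (e + D).
have eD : 0 < e + D by lra.
have uE : u * (e + D) = e by rewrite /u divfK // gt_eqF.
have u0 : 0 < u by exact: divr_gt0.
have u1 : u <= 1 by rewrite ler_pdivrMr //; lra.
have u01 : 0 <= u <= 1 by rewrite ltW.
have [_ cn] := cnY.
have := cn (l p) (l t) x _ u u01 (line_at_fraction p t u01).
rewrite lineE real_normK ?num_real // -[(p - t) ^+ 2]sqrrN opprB -/D.
have : mdist x (l p) ^+ 2 <= mdist x (l (p + u * (t - p))) ^+ 2.
  by rewrite ler_sqr ?nnegrE ?mdist_ge0.
move=> h1 h2; have {h1 h2} h := le_trans h1 h2.
set A := mdist x (l p) ^+ 2 in h *; set B := mdist x (l t) ^+ 2 in h *.
have {h} : 0 <= u * (B - A - (1 - u) * D) by lra.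
rewrite pmulr_rge0 // => h; nra.
Qed.

Lemma pythagoras (x : Y) (t : R) :
  height l x ^+ 2 + (t - foot l x) ^+ 2 <= mdist x (l t) ^+ 2.
Proof. exact: foot_at_pythagoras (footP x). Qed.

Lemma height_ge0 (x : Y) : 0 <= height l x. Proof. exact: mdist_ge0. Qed.

Lemma height_le (x : Y) (t : R) : height l x <= mdist x (l t).
Proof. exact: footP. Qed.

Lemma footE (x : Y) (t : R) : foot_at l x t -> foot l x = t.
Proof.
move=> ft; have := pythagoras x t; have := ft (foot l x).
rewrite -/(height l x) => h1 h2; apply/eqP; rewrite eq_sym -subr_eq0 -sqrf_eq0.
rewrite eq_le sqr_ge0 andbT.
have : mdist x (l t) ^+ 2 <= height l x ^+ 2.
  by rewrite ler_sqr ?nnegrE ?mdist_ge0 ?height_ge0.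
lra.
Qed.

Lemma height_lip (x y : Y) : height l x <= mdist x y + height l y.
Proof. exact: le_trans (height_le x (foot l y)) (metric_triangle _ _ _). Qed.

(** The pair (foot, height) maps Y to the Euclidean plane without increasing
    distances.  In the quadrilateral formed by x, y and their projections the
    diagonals are bounded below by the right angles at the feet and above by
    quadrilateral, whose optimal weight produces the mixed term
    2 * height x * height y. *)
Lemma foot_height_nonexpanding (x y : Y) :
  (foot l x - foot l y) ^+ 2 + (height l x - height l y) ^+ 2 <= mdist x y ^+ 2.
Proof.
have hx := height_ge0 x; have hy := height_ge0 y.
have px := pythagoras x (foot l y); have py := pythagoras y (foot l x).
have [x0|xN0] := eqVneq (height l x) 0.
  have ex : x = l (foot l x) by exact: mdist_positivity.
  by rewrite x0 sub0r sqrrN [X in mdist X]ex (metric_sym _ y); lra.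
have [y0|yN0] := eqVneq (height l y) 0.
  have ey : y = l (foot l y) by exact: mdist_positivity.
  by rewrite y0 subr0 [X in mdist _ X]ey; lra.
have {}hx : 0 < height l x by rewrite lt_neqAle eq_sym xN0.
have {}hy : 0 < height l y by rewrite lt_neqAle eq_sym yN0.
have hxy := addr_gt0 hx hy.
pose t := height l x / (height l x + height l y).
have t01 : 0 < t < 1.
  by rewrite divr_gt0 //= ltr_pdivrMr // mul1r ltrDl.
have := quadrilateral cnY x (l (foot l x)) (l (foot l y)) y t01.
rewrite -/(height l x) (metric_sym (l (foot l x)) y) (metric_sym (l (foot l y)) y)
  -/(height l y) lineE.
rewrite real_normK ?num_real //.
have -> : (1 - t) / t * height l x ^+ 2 = height l x * height l y.
  by rewrite /t; field; rewrite ?gt_eqF.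
have -> : t / (1 - t) * height l y ^+ 2 = height l x * height l y.
  have -> : 1 - t = height l y / (height l x + height l y).
    by rewrite /t; field; rewrite ?gt_eqF.
  by rewrite /t; field; rewrite ?gt_eqF.
nra.
Qed.

Lemma foot_lip (x y : Y) : `|foot l x - foot l y| <= mdist x y.
Proof.
apply: ge0_sqr_le; first exact: mdist_ge0.
rewrite real_normK ?num_real //; have := foot_height_nonexpanding x y.
by have := sqr_ge0 (height l x - height l y); lra.
Qed.

(** Going from x straight towards its projection preserves the projection. *)
Lemma foot_vertical (x m : Y) (t : R) : 0 <= t <= 1 ->
  at_fraction (l (foot l x)) x t m ->
  foot l m = foot l x /\ height l m = t * height l x.
Proof.
move=> t01 [lm mx].
have e : mdist m (l (foot l x)) = t * height l x.
  by rewrite metric_sym lm metric_sym.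
suff f : foot l m = foot l x by rewrite {1}/height f.
apply: footE => s; rewrite e.
have := metric_triangle x m (l s); rewrite (metric_sym x m) mx.
have := height_le x s; rewrite -(metric_sym x) -/(height l x); lra.
Qed.

Lemma foot_shift (f : Y -> Y) (a : R) (x : Y) :
  (forall y z, mdist (f y) (f z) = mdist y z) -> (forall t, f (l t) = l (t + a)) ->
  foot l (f x) = foot l x + a /\ height l (f x) = height l x.
Proof.
move=> isof fl.
suff e : foot l (f x) = foot l x + a by rewrite /height e -fl isof.
apply: footE => s; rewrite -fl isof -(subrK a s) -fl isof; exact: footP.
Qed.

End Foot.

(** * Almost flat quadrilaterals *)

Section FlatQuadrilateral.
Variables (R : realType) (Y : metricType R) (l : R -> Y).
Hypothesis cnY : CN_space Y.
Hypothesis line_l : geodesic_line l.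

(** Upper bounds by plane distances, up to an additive error eta on squares,
    propagate from the endpoints of a geodesic to its points: the CN inequality
    is an equality in the plane, and its negative term only needs the geodesic
    to be at least as long as the plane segment. *)
Lemma stewart_step (z X1 X2 m : Y) (a b a1 b1 a2 b2 u eta : R) :
  0 <= u <= 1 -> at_fraction X1 X2 u m ->
  (a1 - a2) ^+ 2 + (b1 - b2) ^+ 2 <= mdist X1 X2 ^+ 2 ->
  mdist z X1 ^+ 2 <= (a - a1) ^+ 2 + (b - b1) ^+ 2 + eta ->
  mdist z X2 ^+ 2 <= (a - a2) ^+ 2 + (b - b2) ^+ 2 + eta ->
  mdist z m ^+ 2 <= (a - ((1 - u) * a1 + u * a2)) ^+ 2
                    + (b - ((1 - u) * b1 + u * b2)) ^+ 2 + eta.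
Proof.
move=> u01 fm h12 h1 h2; have [_ cn] := cnY.
apply: le_trans (cn _ _ z _ _ u01 fm) _; have [u0 u1] := andP u01.
have u1' : 0 <= 1 - u by lra.
have g1 := ler_wpM2l u1' h1; have g2 := ler_wpM2l u0 h2.
have g3 := ler_wpM2l (mulr_ge0 u0 u1') h12.
apply: le_trans (lerB (lerD g1 g2) g3) _.
by rewrite le_eqVlt; apply/orP; left; apply/eqP; ring.
Qed.

(** A quadrilateral with base of length 2 k on l, two sides of length k
    perpendicular to l and a top of length at most 2 k + eps is, up to an error
    of order k * eps on squared distances, a flat rectangle: v s t stands for
    the point of abscissa m + s and ordinate t.  It is the point of the geodesic
    that joins the points of height t of the two sides.

    Upper bounds: the base and the sides are exact, the top is given, the
    diagonals are controlled by quadrilateral, and stewart_step carries the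
    bounds first to the sides and then to the horizontal geodesics.  Lower
    bounds follow from foot_height_nonexpanding: the horizontal geodesics have
    almost the length of the displacement of the foot, so they cannot change
    height. *)
Lemma almost_flat_quadrilateral (x y : Y) (m k eps : R) :
  0 < k -> 0 <= eps -> foot l x = m - k -> foot l y = m + k ->
  height l x = k -> height l y = k -> mdist x y <= 2 * k + eps ->
  exists v : R -> R -> Y, forall s t, `|s| <= k -> 0 <= t <= k ->
    [/\ `|foot l (v s t) - (m + s)| <= eps,
        (height l (v s t) - t) ^+ 2 <= 4 * k * eps + eps ^+ 2 &
        forall s' t', `|s'| <= k -> 0 <= t' <= k ->
          mdist (v s t) (v s' t') ^+ 2 <=
            (s - s') ^+ 2 + (t - t') ^+ 2 + (4 * k * eps + eps ^+ 2)].
Proof.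
move=> k0 eps0 fx fy hx hy dxy.
set eta := 4 * k * eps + eps ^+ 2.
have eta0 : 0 <= eta by rewrite addr_ge0 ?sqr_ge0 // !mulr_ge0 // ltW.
pose frac t := t / k.
pose hfrac s := (s + k) / (2 * k).
have fracP t : 0 <= t <= k -> 0 <= frac t <= 1.
  by move=> /andP[t0 t1]; rewrite divr_ge0 ?(ltW k0) //= ler_pdivrMr // mul1r.
have hfracP s : `|s| <= k -> 0 <= hfrac s <= 1.
  rewrite ler_norml => /andP[s0 s1]; rewrite divr_ge0 /=; [|lra|lra].
  by rewrite ler_pdivrMr; lra.
have fracE t : frac t * k = t by rewrite divfK // gt_eqF.
have hfracE s : hfrac s * (2 * k) = s + k by rewrite divfK // gt_eqF //; lra.
have side (z : Y) : exists w : R -> Y, forall t, 0 <= t <= k ->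
    at_fraction (l (foot l z)) z (frac t) (w t).
  suff /choice[w hw] : forall t : R, exists w : Y, 0 <= t <= k ->
    at_fraction (l (foot l z)) z (frac t) w by exists w.
  move=> t; case: (boolP (0 <= t <= k)) => [tk|_]; last by exists z.
  by have [w hw] := at_fraction_exists cnY (l (foot l z)) z (fracP _ tk); exists w.
have [X XP] := side x; have [W WP] := side y.
have [v vP] : exists v : R -> R -> Y, forall s t, `|s| <= k -> 0 <= t <= k ->
    at_fraction (X t) (W t) (hfrac s) (v s t).
  suff /choice[v hv] : forall st : R * R, exists v : Y, `|st.1| <= k ->
      0 <= st.2 <= k -> at_fraction (X st.2) (W st.2) (hfrac st.1) v.
    by exists (fun s t => v (s, t)) => s t hs ht; apply: (hv (s, t)).
  move=> [s t] /=; case: (boolP (`|s| <= k)) => [sk|_]; last by exists x.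
  by have [w hw] := at_fraction_exists cnY (X t) (W t) (hfracP _ sk); exists w.
have Xft t : 0 <= t <= k -> foot l (X t) = m - k /\ height l (X t) = t.
  move=> tk; have := foot_vertical cnY line_l (fracP _ tk) (XP _ tk).
  by rewrite fx hx fracE.
have Wft t : 0 <= t <= k -> foot l (W t) = m + k /\ height l (W t) = t.
  move=> tk; have := foot_vertical cnY line_l (fracP _ tk) (WP _ tk).
  by rewrite fy hy fracE.
have XW t : 0 <= t <= k -> 2 * k <= mdist (X t) (W t) <= 2 * k + eps.
  move=> tk; apply/andP; split.
    have := foot_lip cnY line_l (W t) (X t).
    rewrite (Wft t tk).1 (Xft t tk).1 (metric_sym (W t)).
    by apply: le_trans; apply: le_trans (ler_norm _); lra.
  have := distance_convex cnY (fracP _ tk) (XP _ tk) (WP _ tk).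
  rewrite (lineE line_l) fx fy.
  have -> : m - k - (m + k) = - (2 * k) by ring.
  rewrite normrN ger0_norm; last lra.
  have /andP[f0 f1] := fracP _ tk; have := ler_wpM2l f0 dxy; nra.
have kt : 0 <= k <= k by rewrite ltW //=.
have pq : mdist (l (m - k)) (l (m + k)) = 2 * k.
  rewrite lineE //; have -> : m - k - (m + k) = - (2 * k) by ring.
  by rewrite normrN ger0_norm //; lra.
have px : mdist (l (m - k)) x = k by rewrite metric_sym -fx -/(height l x).
have qy : mdist (l (m + k)) y = k by rewrite metric_sym -fy -/(height l y).
have xyge : 2 * k <= mdist x y.
  have := foot_lip cnY line_l y x; rewrite fx fy metric_sym.
  by apply: le_trans; apply: le_trans (ler_norm _); lra.
have xysq : mdist x y ^+ 2 <= (2 * k) ^+ 2 + eta by rewrite /eta; nra.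
have diag := quadrilateral cnY (l (m - k)) (l (m + k)) y x.
have {}diag : mdist (l (m - k)) y ^+ 2 + mdist (l (m + k)) x ^+ 2 <=
    2 * k ^+ 2 + 2 * (2 * k) ^+ 2 + eta.
  have := diag (1 / 2); rewrite px qy pq (metric_sym y x).
  have -> : (1 - 1 / 2) / (1 / 2) = 1 :> R by field.
  have -> : (1 / 2) / (1 - 1 / 2) = 1 :> R by field.
  by rewrite !mul1r => h; have := h _; lra.
have qx1 := pythagoras cnY line_l x (m + k).
have py1 := pythagoras cnY line_l y (m - k).
rewrite hx fx (metric_sym x) in qx1; rewrite hy fy (metric_sym y) in py1.
have qx : mdist (l (m + k)) x ^+ 2 <= k ^+ 2 + (2 * k) ^+ 2 + eta by nra.
have py : mdist (l (m - k)) y ^+ 2 <= k ^+ 2 + (2 * k) ^+ 2 + eta by nra.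
(* z behaves like the plane point (a, b) as seen from the four corners
   (- k, 0), (k, 0), (- k, k) and (k, k). *)
pose good z a b := [/\ mdist z (l (m - k)) ^+ 2 <= (a + k) ^+ 2 + b ^+ 2 + eta,
  mdist z (l (m + k)) ^+ 2 <= (a - k) ^+ 2 + b ^+ 2 + eta,
  mdist z x ^+ 2 <= (a + k) ^+ 2 + (b - k) ^+ 2 + eta &
  mdist z y ^+ 2 <= (a - k) ^+ 2 + (b - k) ^+ 2 + eta].
have hull z a b s t : good z a b -> `|s| <= k -> 0 <= t <= k ->
    mdist z (v s t) ^+ 2 <= (a - s) ^+ 2 + (b - t) ^+ 2 + eta.
  move=> [zp zq zx zy] sk tk.
  have zX : mdist z (X t) ^+ 2 <= (a - - k) ^+ 2 + (b - t) ^+ 2 + eta.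
    have := @stewart_step z (l (foot l x)) x (X t) a b (- k) 0 (- k) k _ eta
      (fracP _ tk) (XP _ tk).
    rewrite mulr0 fracE fx px.
    have -> : (1 - frac t) * - k + frac t * - k = - k by ring.
    rewrite (add0r t); apply.
    - by rewrite subrr expr0n /= add0r sub0r sqrrN.
    - by rewrite opprK subr0.
    - by rewrite opprK.
  have zW : mdist z (W t) ^+ 2 <= (a - k) ^+ 2 + (b - t) ^+ 2 + eta.
    have := @stewart_step z (l (foot l y)) y (W t) a b k 0 k k _ eta
      (fracP _ tk) (WP _ tk).
    rewrite mulr0 fracE fy qy.
    have -> : (1 - frac t) * k + t = k by rewrite mulrBl fracE; ring.
    rewrite (add0r t); apply.
    - by rewrite subrr expr0n /= add0r sub0r sqrrN.
    - by rewrite subr0.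
    - by [].
  have := @stewart_step z (X t) (W t) (v s t) a b (- k) t k t _ eta
      (hfracP _ sk) (vP _ _ sk tk).
  have -> : (1 - hfrac s) * t + hfrac s * t = t by ring.
  have -> : (1 - hfrac s) * - k + hfrac s * k = s.
    have -> : (1 - hfrac s) * - k + hfrac s * k = hfrac s * (2 * k) - k by ring.
    by rewrite hfracE addrK.
  apply=> //; have /andP[XW1 _] := XW t tk.
  rewrite subrr expr0n addr0 /=; nra.
exists v => s t sk tk.
have gooddiag : good (v s t) s t.
  split.
  - rewrite metric_sym; have := @hull (l (m - k)) (- k) 0 s t.
    rewrite sub0r sqrrN -opprD sqrrN (addrC k); apply=> //.
    split; rewrite ?mdistxx ?pq ?px; nra.
  - rewrite metric_sym; have := @hull (l (m + k)) k 0 s t.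
    rewrite sub0r sqrrN -[(s - k) ^+ 2]sqrrN opprB; apply=> //.
    by split; rewrite ?mdistxx ?(metric_sym _ (l (m - k))) ?pq ?qy; nra.
  - rewrite metric_sym; have := @hull x (- k) k s t.
    rewrite -opprD sqrrN (addrC k) -[(t - k) ^+ 2]sqrrN opprB; apply=> //.
    by split; rewrite ?mdistxx ?(metric_sym x (l _)) ?px; nra.
  - rewrite metric_sym; have := @hull y k k s t.
    rewrite -[(s - k) ^+ 2]sqrrN opprB -[(t - k) ^+ 2]sqrrN opprB; apply=> //.
    by split; rewrite ?mdistxx ?(metric_sym y (l _)) ?(metric_sym y x) ?qy; nra.
have [vX vW] := vP _ _ sk tk.
have /andP[XW1 XW2] := XW t tk.
have [Xf Xh] := Xft t tk; have [Wf Wh] := Wft t tk.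
have /andP[u0 u1] := hfracP _ sk.
have [l1 l2] : mdist (X t) (v s t) <= s + k + eps /\
               mdist (v s t) (W t) <= k - s + eps.
  rewrite vX vW -(hfracE s).
  have -> : k - s = (1 - hfrac s) * (2 * k).
    by rewrite mulrBl hfracE; ring.
  have u1' : 0 <= 1 - hfrac s by lra.
  have := ler_wpM2l u0 XW2; have := ler_wpM2l u1' XW2; nra.
have f1 := foot_lip cnY line_l (X t) (v s t).
have f2 := foot_lip cnY line_l (v s t) (W t).
rewrite Xf ler_norml in f1; rewrite Wf ler_norml in f2.
have /andP[f1a f1b] := f1; have /andP[f2a f2b] := f2.
split; first by rewrite ler_norml; lra.
- have sum : mdist (X t) (v s t) + mdist (v s t) (W t) <= 2 * k + eps.
    by rewrite vX vW -mulrDl addrC subrK mul1r.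
  have := foot_height_nonexpanding cnY line_l (X t) (v s t); rewrite Xf Xh.
  set D := (height l (v s t) - t) ^+ 2; rewrite -[(t - _) ^+ 2]sqrrN opprB -/D.
  set c := foot l (v s t) - (m - k).
  rewrite -[(m - k - _) ^+ 2]sqrrN opprB -/c => h.
  have hc : mdist (X t) (v s t) <= c + eps by rewrite /c; lra.
  have dv := mdist_ge0 (X t) (v s t).
  have cge : - eps <= c by lra.
  (* The foot may overshoot the right-hand side by at most eps. *)
  have [c0|c0] := leP c (2 * k); last first.
    have : D <= (mdist (X t) (v s t)) ^+ 2 - c ^+ 2 by lra.
    have : mdist (X t) (v s t) <= 2 * k + eps.
      by have := mdist_ge0 (v s t) (W t); lra.
    rewrite /eta; nra.
  have : mdist (X t) (v s t) ^+ 2 <= (c + eps) ^+ 2.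
    by rewrite ler_sqr ?nnegrE //; lra.
  rewrite /eta; nra.
- by move=> s' t' sk' tk'; exact: hull.
Qed.

End FlatQuadrilateral.

(** * Transversal expansion of a line without flat half-plane *)

Definition balls_in_compacts (R : realType) (Y : metricType R) : Prop :=
  forall (x : Y) (r : R), exists2 K : set Y, compact K &
    forall y, mdist x y <= r -> K y.

(** Isometries that translate the line bring each of its points into one
    compact stretch; the axis of a hyperbolic isometry is the main example. *)
Definition recurrent_line (R : realType) (Y : metricType R) (l : R -> Y)
    (tau : R) : Prop :=
  forall r, exists (f : Y -> Y) (a : R),
    [/\ forall y z, mdist (f y) (f z) = mdist y z,
        forall t, f (l t) = l (t + a) & 0 <= r + a <= tau].

Lemma ultra_compact_cvg (I : Type) (T : topologicalType) (U : set_system I)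
    (f : I -> T) (K : set T) :
  UltraFilter U -> compact K -> U (f @^-1` K) -> exists2 y, K y & f @ U --> y.
Proof.
move=> ultraU cK UK; have pU : ProperFilter U by exact: ultra_proper.
have [y [Ky cy]] := cK (f @ U) _ UK; exists y => // B yB.
have [//|nB] := in_ultra_setVsetC (f @^-1` B) ultraU.
by have [z []] := cy (~` B) B nB yB.
Qed.

Section Expansion.
Variables (R : realType) (Y : metricType R) (l : R -> Y) (tau : R).
Hypothesis cnY : CN_space Y.
Hypothesis line_l : geodesic_line l.
Hypothesis properY : balls_in_compacts Y.
Hypothesis rec_l : recurrent_line l tau.
Hypothesis no_half_plane : ~ bounds_flat_half_plane l.

(** Along an ultrafilter the rectangles v n, whose sizes tend to infinity and
    whose errors tend to 0, converge pointwise, because v n s t stays in a ball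
    that depends on s and t only.  The limit h p has exactly the coordinates
    (c + p.1, p.2), hence h does not decrease distances by
    foot_height_nonexpanding; the distances in its image are bounded above by
    the limits of those in the rectangles. *)
Lemma half_plane_of_flat_boxes :
  (forall n : nat, exists (m : R) (v : R -> R -> Y), 0 <= m <= tau /\
    forall s t, `|s| <= n.+1%:R -> 0 <= t <= n.+1%:R ->
    [/\ `|foot l (v s t) - (m + s)| <= n.+1%:R^-1,
        (height l (v s t) - t) ^+ 2 <= 5 * n.+1%:R^-1 &
        forall s' t', `|s'| <= n.+1%:R -> 0 <= t' <= n.+1%:R ->
          mdist (v s t) (v s' t') ^+ 2 <=
            (s - s') ^+ 2 + (t - t') ^+ 2 + 5 * n.+1%:R^-1]) ->
  bounds_flat_half_plane l.
Proof.
move=> /choice[m /choice[v mv]].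
have [U [ultraU leU]] := @ultraFilterLemma nat \oo _.
have properU : ProperFilter U by exact: ultra_proper.
have US (A B : set nat) : U A -> (forall n, A n -> B n) -> U B.
  by move=> UA AB; exact: (filterS AB UA).
have small (e : R) : 0 < e -> U [set n | 5 * n.+1%:R^-1 <= e].
  move=> e0; apply: leU.
  near=> n => /=. rewrite ler_pdivrMr ?ltr0Sn // mulrC -ler_pdivrMr //.
  rewrite -[n.+1%:R]natr1 ler_wpDr //.
  by near: n; exact: nbhs_infty_ger.
have large (r : R) : U [set n | r <= n.+1%:R].
  apply: leU; near=> n => /=; rewrite -natr1 ler_wpDr //.
  by near: n; exact: nbhs_infty_ger.
have in_compact (f : nat -> Y) (r : R) :
    U [set n | mdist (l 0) (f n) <= r] -> exists y : Y, f @ U --> y.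
  move=> bf; have [K cK hK] := properY (l 0) r.
  have UK : U (f @^-1` K) by apply: filterS bf => n; exact: hK.
  by have [y _ fy] := ultra_compact_cvg ultraU cK UK; exists y.
have [c _ mc] : exists2 c, [set` `[0, tau]] c & m @ U --> c.
  apply: (ultra_compact_cvg ultraU (@segment_compact R 0 tau)).
  apply: filterS filterT => n _ /=.
  by rewrite in_itv /=; have [] := mv n.
have near_c (e : R) : 0 < e -> U [set n | `|c - m n| <= e].
  by move=> e0; have /cvgrPdist_le /(_ e e0) := mc.
have near_v (f : nat -> Y) y (e : R) : f @ U --> y -> 0 < e ->
    U [set n | mdist y (f n) <= e].
  by move=> fy e0; exact: (metricType_numDomainType.cvgr_dist_le fy).
have height_bound n (s t e : R) : 0 < e -> 5 * n.+1%:R^-1 <= e ^+ 2 ->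
    `|s| <= n.+1%:R -> 0 <= t <= n.+1%:R ->
    `|height l (v n s t) - t| <= e.
  move=> e0 ne ns nt; have [_ /(_ s t ns nt)[_ h _]] := mv n.
  apply: ge0_sqr_le; first exact: ltW.
  by rewrite real_normK ?num_real // (le_trans h).
have box (s t : R) : 0 <= t -> U [set n | `|s| <= n.+1%:R /\ 0 <= t <= n.+1%:R].
  move=> t0; apply: (US _ _ (filterI (large `|s|) (large t))) => n [/= -> ->].
  by rewrite t0.
have lim_v (s t : R) : 0 <= t -> exists y : Y, v n s t @[n --> U] --> y.
  move=> t0; apply: (in_compact _ (t + 1 + (tau + `|s| + 1))).
  have := small 1 ltr01.
  move=> s1; apply: (US _ _ (filterI (box s t t0) s1)) => n [[ns nt] /= n1].
  have hb := height_bound n s t 1 ltr01 _ ns nt; rewrite expr1n in hb.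
  have {}hb := hb n1.
  have [/andP[m0 m1] /(_ s t ns nt)[f _ _]] := mv n.
  rewrite metric_sym.
  apply: le_trans (metric_triangle _ (l (foot l (v n s t))) _) _.
  rewrite -/(height l _) lineE // subr0; apply: lerD.
    by move: hb; rewrite ler_norml; lra.
  have n0 : 0 <= n.+1%:R^-1 :> R by rewrite invr_ge0.
  rewrite -[foot l _](subrK (m n + s)).
  apply: le_trans (ler_normD _ _) _.
  have := ler_normD (m n) s; rewrite (ger0_norm m0).
  by move: n1 f n0; set q := n.+1%:R^-1; lra.
have [h hlim] : exists h : R * R -> Y, forall p, 0 <= p.2 ->
    v n p.1 p.2 @[n --> U] --> h p.
  suff /choice[h hh] : forall p : R * R, exists y : Y, 0 <= p.2 ->
    v n p.1 p.2 @[n --> U] --> y by exists h.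
  move=> p; case: (leP 0 p.2) => [p0|_]; last by exists (l 0).
  by have [y hy] := lim_v p.1 p.2 p0; exists y.
have footh (p : R * R) : 0 <= p.2 -> foot l (h p) = c + p.1.
  move=> p0; apply/eqP; rewrite -subr_eq0 -normr_le0; apply/ler_addgt0Pl => e e0.
  have e3 : 0 < e / 3 by rewrite divr_gt0.
  have [n [[[ns nt] n1] [n2 n3]]] := filter_ex (filterI
    (filterI (box p.1 p.2 p0) (small _ e3))
    (filterI (near_c _ e3) (near_v _ _ _ (hlim p p0) e3))).
  have [_ /(_ p.1 p.2 ns nt)[f _ _]] := mv n.
  have g := foot_lip cnY line_l (h p) (v n p.1 p.2).
  have n0 : 0 <= n.+1%:R^-1 :> R by rewrite invr_ge0.
  rewrite /= in n1 n2 n3.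
  by move: n1 n0 f g n2; set q := n.+1%:R^-1; rewrite !ler_norml; lra.
have heighth (p : R * R) : 0 <= p.2 -> height l (h p) = p.2.
  move=> p0; apply/eqP; rewrite -subr_eq0 -normr_le0; apply/ler_addgt0Pl => e e0.
  have e3 : 0 < e / 2 by rewrite divr_gt0.
  have e4 : 0 < (e / 2) ^+ 2 by rewrite exprn_gt0.
  have [n [[[ns nt] n1] n3]] := filter_ex (filterI
    (filterI (box p.1 p.2 p0) (small _ e4))
    (near_v _ _ _ (hlim p p0) e3)).
  have f := height_bound n p.1 p.2 _ e3 n1 ns nt.
  have g1 := height_lip line_l (h p) (v n p.1 p.2).
  have g2 := height_lip line_l (v n p.1 p.2) (h p).
  rewrite /= (metric_sym (v n _ _)) in n3 g2.
  move: f; rewrite !ler_norml; lra.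
exists h.
  move=> p q /= p0 q0; apply/eqP; rewrite eq_le; apply/andP; split; last first.
    apply: ge0_sqr_le; first exact: mdist_ge0.
    rewrite edist_sqr; have := foot_height_nonexpanding cnY line_l (h p) (h q).
    by rewrite !footh // !heighth // opprD addrACA subrr add0r.
  apply/ler_addgt0Pl => e e0.
  have e3 : 0 < e / 3 by rewrite divr_gt0.
  have e4 : 0 < (e / 3) ^+ 2 by rewrite exprn_gt0.
  have [n [[[ns nt] [ns' nt']] [n1 [n2 n3]]]] := filter_ex (filterI
    (filterI (box p.1 p.2 p0) (box q.1 q.2 q0)) (filterI (small _ e4)
    (filterI (near_v _ _ _ (hlim p p0) e3) (near_v _ _ _ (hlim q q0) e3)))).
  have [_ /(_ p.1 p.2 ns nt)[_ _ /(_ q.1 q.2 ns' nt')]] := mv n.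
  rewrite -edist_sqr => D.
  have E0 := edist_ge0 p q.
  have : mdist (v n p.1 p.2) (v n q.1 q.2) <= edist p q + e / 3.
    apply: ge0_sqr_le; first by rewrite addr_ge0 // ltW.
    by move: n1 D; rewrite /=; set w := n.+1%:R^-1; nra.
  have := metric_triangle (h p) (v n p.1 p.2) (h q).
  have := metric_triangle (v n p.1 p.2) (v n q.1 q.2) (h q).
  rewrite (metric_sym (v n q.1 q.2)); rewrite /= in n2 n3; lra.
have h_base (s : R) : h (s, 0) = l (c + s).
  apply: mdist_positivity; have := heighth (s, 0) (lexx _).
  by rewrite /height footh.
apply/seteqP; split => [y [[s t] /= -> <-]|y [r _ <-]].
  by exists (c + s) => //; rewrite h_base.
by exists (r - c, 0) => //=; rewrite h_base addrC subrK.
Unshelve. all: by end_near. Qed.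

(** Otherwise there are for every k points at height k with feet 2 k apart and
    at distance at most 2 k + 1 / k ^ 2; translated towards the compact
    stretch, they span rectangles with an error of order 1 / k, whose limit is
    a flat half-plane bounded by l. *)
Lemma expansion : exists S0 L e : R, [/\ 0 < S0, 0 < L, 0 < e &
  forall x y, foot l y - foot l x = L -> height l x = S0 -> height l y = S0 ->
    L + e <= mdist x y].
Proof.
apply: contrapT => nexp; apply: no_half_plane; apply: half_plane_of_flat_boxes => n.
pose k : R := n.+1%:R; have k0 : 0 < k by rewrite ltr0Sn.
have k1 : 1 <= k by rewrite ler1n.
have [x [y [fxy hx hy dxy]]] : exists x y, [/\ foot l y - foot l x = 2 * k,
   height l x = k, height l y = k & mdist x y <= 2 * k + (k ^+ 2)^-1].
  apply: contrapT => H; apply: nexp; exists k, (2 * k), ((k ^+ 2)^-1); split=> //.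
  - by rewrite mulr_gt0.
  - by rewrite invr_gt0 exprn_gt0.
  move=> x y fxy hx hy; rewrite leNgt; apply/negP => lt.
  by apply: H; exists x, y; split=> //; exact: ltW.
have [f [a [isof fl mid]]] := rec_l (foot l x + k).
have [fx' hx'] := foot_shift cnY line_l x isof fl.
have [fy' hy'] := foot_shift cnY line_l y isof fl.
have kk : (k ^+ 2)^-1 = k^-1 * k^-1 by rewrite expr2 invfM.
have ki1 : k^-1 <= 1 by rewrite invf_le1.
have ki0 : 0 < k^-1 by rewrite invr_gt0.
have kki : k * k^-1 = 1 by rewrite divff // gt_eqF.
have [||||||v vP] := @almost_flat_quadrilateral R Y l cnY line_l (f x) (f y)
  (foot l x + k + a) k ((k ^+ 2)^-1) k0 _ _ _ _ _ _.
- by rewrite ltW // invr_gt0 exprn_gt0.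
- by rewrite fx'; ring.
- by rewrite fy'; lra.
- by rewrite hx'.
- by rewrite hy'.
- by rewrite isof.
exists (foot l x + k + a), v; split=> // s t sk tk.
have eps_le : (k ^+ 2)^-1 <= k^-1 by rewrite kk ler_piMl // ltW.
have eta_le : 4 * k * (k ^+ 2)^-1 + ((k ^+ 2)^-1) ^+ 2 <= 5 * k^-1.
  have -> : 4 * k * (k ^+ 2)^-1 = 4 * k^-1.
    by rewrite kk -mulrA (mulrA k) kki mul1r.
  have a0 : 0 <= (k ^+ 2)^-1 by rewrite invr_ge0 exprn_ge0 // ltW.
  have : ((k ^+ 2)^-1) ^+ 2 <= (k ^+ 2)^-1.
    by rewrite expr2 ler_piMl // (le_trans eps_le).
  by move: eps_le; move: ((k ^+ 2)^-1) (k^-1) => u w; lra.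
have [f1 f2 f3] := vP s t sk tk; split.
- exact: le_trans f1 eps_le.
- exact: le_trans f2 eta_le.
- move=> s' t' sk' tk'; apply: le_trans (f3 _ _ sk' tk') _.
  by rewrite lerD2l.
Qed.

End Expansion.

(** * Geodesics high above an expanding line *)

Lemma first_passage (R : realType) (f : R -> R) (T S : R) :
  (forall s t, `|f s - f t| <= `|s - t|) ->
  0 <= T -> S < f 0 -> f T <= S ->
  exists t0, [/\ 0 <= t0, f t0 <= S & forall t, 0 <= t <= t0 -> S <= f t].
Proof.
move=> lip T0 f0 fT; pose E := [set t | 0 <= t /\ f t <= S].
have hE : has_inf E.
  by split; [exists T | exists 0 => t []].
have i0 : 0 <= inf E by apply: lb_le_inf; [exists T | move=> t []].
have before t : 0 <= t -> t < inf E -> S < f t.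
  move=> t0 ti; rewrite ltNge; apply/negP => ft.
  have : inf E <= t by apply: ge_inf; [exists 0 => u []|].
  by rewrite leNgt ti.
have fi : f (inf E) <= S.
  apply/ler_addgt0Pl => e e0; have [t [t0 ft] ti] := inf_adherent e0 hE.
  have it : inf E <= t by apply: ge_inf; [exists 0 => u []|].
  have := lip (inf E) t; rewrite [`|inf E - t|]distrC [`|t - inf E|]ger0_norm ?subr_ge0 //.
  rewrite ler_norml; lra.
exists (inf E); split=> // t /andP[t0]; rewrite le_eqVlt => /orP[/eqP ->|ti]; last first.
  exact/ltW/before.
apply/ler_addgt0Pl => e e0.
have ipos : 0 < inf E.
  by rewrite lt_neqAle i0 andbT; apply/eqP => i00; move: fi; rewrite -i00; lra.
pose u := Num.max 0 (inf E - e).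
have u0 : 0 <= u by rewrite le_max lexx.
have ui : u < inf E by rewrite gt_max ipos /= ltrBlDr ltrDl.
have ue : inf E - e <= u by rewrite le_max lexx orbT.
have := before u u0 ui; have := lip u (inf E).
rewrite [`|u - _|]ler0_norm ?subr_le0 ?(ltW ui) // ler_norml; lra.
Qed.

Section Drift.
Variables (R : realType) (Y : metricType R) (l : R -> Y).
Hypothesis cnY : CN_space Y.
Hypothesis line_l : geodesic_line l.

Definition expanding (S0 L e : R) : Prop :=
  forall x y, foot l y - foot l x = L -> height l x = S0 -> height l y = S0 ->
    L + e <= mdist x y.

Lemma lowered_point (x : Y) (s : R) : 0 < s <= height l x ->
  exists m, [/\ at_fraction (l (foot l x)) x (s / height l x) m,
    foot l m = foot l x & height l m = s].
Proof.
move=> /andP[s0 sx]; have hx : 0 < height l x by lra.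
have u01 : 0 <= s / height l x <= 1.
  by rewrite (divr_ge0 (ltW s0) (ltW hx)) /= ler_pdivrMr // mul1r.
have [m fm] := at_fraction_exists cnY (l (foot l x)) x u01.
have [f h] := foot_vertical cnY line_l u01 fm.
by exists m; split=> //; rewrite h divfK // gt_eqF.
Qed.

(** Lower y to the height of x.  Along the two perpendiculars the distance is a
    convex function of the height; it equals L at height 0 and exceeds L + e at
    height S0, hence it grows at least linearly.  Lowering y costs at most
    mdist x y, whence the factor 1 / 2. *)
Lemma expanding_dist (S0 L e S : R) (x y : Y) :
  0 < S0 -> 0 < L -> 0 < e -> expanding S0 L e -> S0 <= S ->
  `|foot l y - foot l x| = L -> S <= height l x -> S <= height l y ->
  e / (2 * S0) * S <= mdist x y.
Proof.
move=> S00 L0 e0 exp S0S.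
wlog hxy : x y / height l x <= height l y.
  move=> W fL Sx Sy; case: (leP (height l x) (height l y)) => h; first exact: W.
  by rewrite metric_sym; apply: W; rewrite 1?distrC // ltW.
move=> fL Sx Sy; have hx0 : 0 < height l x by lra.
have [|y' [[_ y'y] fy' hy']] := @lowered_point y (height l x).
  by rewrite hx0.
have dyy' : mdist y' y = height l y - height l x.
  rewrite y'y mulrBl mul1r (metric_sym _ y) -/(height l y) divfK //.
  by rewrite gt_eqF //; lra.
have [|x0 [fracx fx0 hx0']] := @lowered_point x S0.
  by rewrite S00 (le_trans S0S).
have [|y0 [fracy fy0 hy0']] := @lowered_point y' S0.
  by rewrite S00 hy' (le_trans S0S).
set u := S0 / height l x in fracx; rewrite hy' -/u fy' in fracy.
have u0 : 0 < u by rewrite divr_gt0.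
have u01 : 0 <= u <= 1.
  by rewrite ltW //= ler_pdivrMr // mul1r (le_trans S0S).
have uE : u * height l x = S0 by rewrite divfK // gt_eqF.
have conv := distance_convex cnY u01 fracx fracy.
rewrite (lineE line_l) distrC fL in conv.
have low : L + e <= mdist x0 y0.
  case: (leP 0 (foot l y - foot l x)) => sgn.
    apply: exp => //; rewrite fy0 fx0 fy'.
    by rewrite -fL ger0_norm.
  rewrite metric_sym; apply: exp => //; rewrite fy0 fx0 fy'.
  by rewrite -fL ltr0_norm // opprB.
have far : e / S0 * height l x <= mdist x y'.
  have : e <= u * mdist x y' by have /andP[_ u1] := u01; nra.
  move=> eu; rewrite -(ler_pM2l u0); apply: le_trans eu.
  by rewrite mulrCA uE divfK // gt_eqF.
have := height_lip line_l y x; rewrite (metric_sym y x).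
have := metric_triangle x y y'; rewrite (metric_sym y y') dyy'.
have : e / S0 * S <= e / S0 * height l x by rewrite ler_pM2l // divr_gt0.
have -> : e / (2 * S0) * S = (e / S0 * S) / 2.
  by field; rewrite gt_eqF.
lra.
Qed.

Definition isometric_path (c : R -> Y) (a b : R) : Prop :=
  forall s t, a <= s <= b -> a <= t <= b -> mdist (c s) (c t) = `|s - t|.

(** Cut the path at a point where its foot has moved by exactly L, which exists
    by continuity, and repeat. *)
Lemma path_length (L w S : R) (c : R -> Y) (b : R) (k : nat) : 0 < L ->
  (forall x y, `|foot l y - foot l x| = L -> S <= height l x ->
     S <= height l y -> w <= mdist x y) ->
  forall a, a <= b -> isometric_path c a b ->
  (forall t, a <= t <= b -> S <= height l (c t)) ->
  k%:R * L <= `|foot l (c b) - foot l (c a)| -> k%:R * w <= b - a.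
Proof.
move=> L0 sep; elim: k => [|k IH] a ab iso high.
  by rewrite !mul0r subr_ge0.
rewrite -natr1 => far.
pose F t := `|foot l (c t) - foot l (c a)|.
have aa : a <= a <= b by rewrite lexx.
have bb : a <= b <= b by rewrite lexx andbT.
have cF : {within `[a, b], continuous F}.
  apply: lipschitz_within_continuous => // s t sab tab.
  apply: le_trans (ler_dist_dist _ _) _.
  rewrite opprB addrA subrK -iso //; exact: foot_lip.
have k0 : 0 <= k%:R * L by rewrite mulr_ge0 // ltW.
have Fa : F a = 0 by rewrite /F subrr normr0.
have Fb : L <= F b by rewrite /F; lra.
have [|t] := @IVT R F a b L ab cF.
  by rewrite Fa min_l ?max_r ?(ltW L0) //=; exact: normr_ge0.
rewrite in_itv /= => /andP[at_ tb] Ft.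
have tab : a <= t <= b by rewrite at_.
have step : w <= t - a.
  have := sep (c a) (c t) Ft (high _ aa) (high _ tab).
  by rewrite iso // distrC ger0_norm // subr_ge0.
have := IH t tb; have -> : b - a = (b - t) + (t - a) by ring.
move=> H; rewrite mulrDl mul1r lerD //; apply: H.
- move=> u v /andP[tu ub] /andP[tv vb]; apply: iso.
    by rewrite ub (le_trans at_).
  by rewrite vb (le_trans at_).
- by move=> u /andP[tu ub]; apply: high; rewrite ub (le_trans at_).
- have : F b <= F t + `|foot l (c b) - foot l (c t)|.
    rewrite addrC /F; apply: le_trans (ler_normD _ _).
    by rewrite addrA subrK.
  rewrite Ft /F; lra.
Qed.

(** Geodesics that stay at height at least S move their foot by a small fraction
    1 / K of the heights of their endpoints, up to a constant. *)
Definition slow_drift (K L S : R) : Prop :=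
  forall (c : R -> Y) a b, a <= b -> isometric_path c a b ->
    (forall t, a <= t <= b -> S <= height l (c t)) ->
    K * `|foot l (c b) - foot l (c a)| <=
      height l (c a) + height l (c b) + (K + 1) * L.

(** A geodesic whose foot moves by n has length at most n plus the heights of
    its endpoints, by the detour through the line.  On the other hand, once S is
    large, expanding_dist makes each displacement of the foot by L cost a length
    of w = (K + 1) L, so by path_length the geodesic is at least about K + 1
    times as long as n. *)
Lemma slow_drift_exists (S0 L e K C : R) :
  0 < S0 -> 0 < L -> 0 < e -> expanding S0 L e -> 0 <= K ->
  exists2 S, C <= S & slow_drift K L S.
Proof.
move=> S00 L0 e0 exp K0.
pose q := e / (2 * S0); have q0 : 0 < q by rewrite divr_gt0 // mulr_gt0.
pose w := (K + 1) * L; have w0 : 0 <= w by rewrite mulr_ge0 ?ltW //; lra.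
pose S := Num.max S0 (Num.max C (w / q)).
have S0S : S0 <= S by rewrite le_max lexx.
have wS : w <= q * S.
  by rewrite mulrC -ler_pdivrMr // !le_max lexx !orbT.
exists S; first by rewrite !le_max lexx !orbT.
move=> c a b ab iso high; set n := `|_|.
have n0 : 0 <= n by exact: normr_ge0.
pose k := Num.truncn (n / L).
have /andP[k1 k2] : k%:R <= n / L < k.+1%:R.
  by apply: truncn_itv; rewrite divr_ge0 // ltW.
have kL : k%:R * L <= n by rewrite -ler_pdivlMr.
have nL : n < (k%:R + 1) * L by rewrite natr1 -ltr_pdivrMr.
have sep x y : `|foot l y - foot l x| = L -> S <= height l x ->
    S <= height l y -> w <= mdist x y.
  by move=> fL Sx Sy; apply: le_trans wS _; exact: (expanding_dist S00 L0 e0 exp).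
have len := path_length L0 sep ab iso high kL.
have aa : a <= a <= b by rewrite lexx.
have bb : a <= b <= b by rewrite lexx andbT.
have dab : b - a <= height l (c a) + n + height l (c b).
  rewrite -[b - a]ger0_norm ?subr_ge0 // distrC -(iso _ _ aa bb).
  apply: le_trans (metric_triangle _ (l (foot l (c a))) _) _.
  rewrite -addrA lerD2l.
  apply: le_trans (metric_triangle _ (l (foot l (c b))) _) _.
  by rewrite (lineE line_l) distrC lerD2l metric_sym.
rewrite /w in len; nra.
Qed.

(** If z is at distance about N from l and at most N from another line l', which
    passes close to l somewhere, then the projection of z on l is only at about
    3 / 4 N from l'.

    Follow a geodesic from z to l': during its first N / 2 it stays high above
    l, so its foot hardly moves; the second half moves the foot by at most
    N / 2.  Then follow l' from there towards l until height S: again the foot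
    hardly moves, and a point of l' close to l has been reached.  The two
    drifts add up to at most (5 / 2 + 2) N / 18 = N / 4, up to a constant. *)
Lemma lines_approach (L S C N a b : R) (l' : R -> Y) (z : Y) :
  0 < L -> 0 <= S -> C <= S -> slow_drift 18 L S -> geodesic_line l' ->
  N - 1 <= height l z <= N -> mdist z (l' a) <= N -> height l (l' b) <= C ->
  exists t, mdist (l (foot l z)) (l' t) <= 3 / 4 * N + (4 * S + 4 + 3 * L).
Proof.
move=> L0 S0 CS drift line' /andP[Nz zN] za hb.
have h0 : 0 <= height l z := height_ge0 _ _.
(* For bounded N the additive constant absorbs everything. *)
case: (ltP (N / 2 - 1) S) => NS.
  exists a; apply: le_trans (metric_triangle _ z _) _.
  rewrite metric_sym -/(height l z); lra.
have [geoY _] := cnY.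
have [c [c0 cD iso]] := geoY z (l' a).
set D := mdist z (l' a) in cD iso za *.
have D0 : 0 <= D by exact: mdist_ge0.
pose D' := Num.min D (N / 2).
have D'0 : 0 <= D' by rewrite le_min D0 /=; lra.
have D'D : D' <= D by rewrite ge_min lexx.
have D'N : D' <= N / 2 by rewrite ge_min lexx orbT.
have DD' : D - D' <= N / 2.
  by rewrite /D'; case: (leP D (N / 2)) => ?; lra.
have in0 : 0 <= (0 : R) <= D by rewrite lexx D0.
have inD' : 0 <= D' <= D by rewrite D'0.
have inD : 0 <= D <= D by rewrite D0 lexx.
have cz t : 0 <= t <= D -> mdist z (c t) = t.
  move=> tD; rewrite -{1}c0 iso // /rdist sub0r normrN ger0_norm //.
  by have /andP[] := tD.
have drift1 : 18 * `|foot l (c D') - foot l z| <=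
    height l z + height l (c D') + 19 * L.
  have := drift c 0 D' D'0; rewrite c0.
  have -> : (18 + 1 : R) = 19 by ring.
  apply.
    move=> s t /andP[s0 s1] /andP[t0 t1]; apply: iso => /=.
      by rewrite s0 (le_trans s1).
    by rewrite t0 (le_trans t1).
  move=> t /andP[t0 t1]; have tD : 0 <= t <= D by rewrite t0 (le_trans t1).
  by have := height_lip line_l z (c t); rewrite cz //; lra.
have hD' : height l (c D') <= N + N / 2.
  have := height_lip line_l (c D') z; rewrite metric_sym cz //; lra.
have foot2 : `|foot l (c D') - foot l (l' a)| <= N / 2.
  apply: le_trans (foot_lip cnY line_l _ _) _.
  by rewrite -cD iso // /rdist distrC ger0_norm ?subr_ge0.
have ha : height l (l' a) <= N + N.
  by have := height_lip line_l (l' a) z; rewrite metric_sym -/D; lra.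
suff [y [y_on hy fy]] : exists y, [/\ range l' y, height l y <= S &
    18 * `|foot l y - foot l (l' a)| <= N + N + S + 19 * L].
  have [t _ ty] := y_on; exists t; rewrite ty.
  apply: le_trans (metric_triangle _ (l (foot l y)) _) _.
  rewrite (lineE line_l) (metric_sym _ y) -/(height l y).
  have := ler_distD (foot l (c D')) (foot l z) (foot l y).
  have := ler_distD (foot l (l' a)) (foot l (c D')) (foot l y).
  rewrite (distrC (foot l z) (foot l (c D'))) (distrC (foot l (l' a)) (foot l y)).
  lra.
case: (leP (height l (l' a)) S) => haS.
  exists (l' a); split=> //.
  by rewrite subrr normr0; lra.
(* l' is followed from a in the direction of b. *)
pose sg : R := if a <= b then 1 else - 1.
have sgE : a + sg * `|b - a| = b.
  rewrite /sg; case: (leP a b) => ab.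
    by rewrite ger0_norm ?subr_ge0 //; ring.
  by rewrite ltr0_norm ?subr_lt0 //; ring.
have sg1 : `|sg| = 1 by rewrite /sg; case: ifP; rewrite ?normrN normr1.
pose c' t := l' (a + sg * t).
have iso' s t : mdist (c' s) (c' t) = `|s - t|.
  rewrite /c' (lineE line') -[RHS]mul1r -sg1 -normrM; congr `| _ |; ring.
have [||||t0 [t00 ft0 high]] := @first_passage R (height l \o c') `|b - a| S.
- move=> s t /=; rewrite -(iso' s t) ler_norml.
  have := height_lip line_l (c' s) (c' t).
  have := height_lip line_l (c' t) (c' s); rewrite (metric_sym (c' t)); lra.
- exact: normr_ge0.
- by rewrite /= /c' mulr0 addr0.
- by rewrite /= /c' sgE (le_trans hb).
exists (c' t0); split=> //.
have : 18 * `|foot l (c' t0) - foot l (c' 0)| <=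
    height l (c' 0) + height l (c' t0) + (18 + 1) * L.
  by apply: drift => // s t _ _; exact: iso'.
have -> : c' 0 = l' a by rewrite /c' mulr0 addr0.
rewrite /= in ft0; lra.
Qed.

End Drift.

(** * Proper cocompact actions *)

Lemma finite_set_ubound (R : realType) (T : Type) (A : set T) (f : T -> R) :
  finite_set A -> exists2 C, 0 <= C & forall x, A x -> f x <= C.
Proof.
move=> finA; have [s sE] : exists s : seq R, f @` A = [set` s].
  by apply/finite_seqP; exact: finite_image.
exists (\sum_(y <- s) `|y|); first by apply: sumr_ge0 => y _.
move=> x Ax; have : f x \in s by have : (f @` A) (f x); [exists x | rewrite sE].
move=> xs; rewrite (big_rem _ xs) /=.
apply: le_trans (ler_norm _) _; rewrite lerDl.
by apply: sumr_ge0 => y _.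
Qed.

Lemma ball_cover_compact (R : realType) (Y : metricType R) (K : set Y)
    (r : Y -> R) : compact K -> (forall x, 0 < r x) ->
  exists s : seq Y, forall y, K y -> exists2 x, x \in s & mdist x y < r x.
Proof.
move=> cK r0; have [[y0 _]|K0] := pselect (K !=set0); last first.
  by exists [::] => y Ky; case: K0; exists y.
(* Open covers are available once Y has a base point. *)
pose Yp : ptopologicalType := HB.pack_for ptopologicalType Y (isPointed.Build Y y0).
have : @cover_compact Yp K by rewrite -compact_cover.
move=> /(_ Y K (fun x => (ball x (r x))°)) [|y Ky|D' _ D'K].
- by move=> x _; exact: open_interior.
- by exists y => //; exact: (@nbhsx_ballx R Y y _ (r0 y)).
exists (finmap.enum_fset D') => y Ky; have [x xD' xy] := D'K _ Ky.
by exists x => //; have := interior_subset xy; rewrite ballEmdist.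
Qed.

Section ProperCocompact.
Variables (R : realType) (G : groupType) (Y : metricType R) (act : G -> Y -> Y).
Hypothesis isoact : isometric_action act.

Lemma actV (g : G) (y : Y) : act g^-1%g (act g y) = y.
Proof. by rewrite -(act_mul isoact) mulVg act_one. Qed.

Lemma actKV (g : G) (y : Y) : act g (act g^-1%g y) = y.
Proof. by rewrite -(act_mul isoact) mulgV act_one. Qed.

Lemma act_move (g : G) (x y : Y) : mdist (act g x) y = mdist x (act g^-1%g y).
Proof. by rewrite -{1}(actKV g y) (act_isometry isoact). Qed.

Hypothesis proper : proper_action act.

(** Properness speaks of returns of a ball to itself; two elements that bring x
    near the same point y differ by such a return. *)
Lemma finite_near_orbit : exists2 r : Y -> R, (forall x, 0 < r x) &
  forall x y, finite_set [set g | mdist (act g x) y < r x].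
Proof.
have /choice[r rP] : forall x, exists r : R, 0 < r /\
    forall y, finite_set [set g | mdist (act g x) y < r].
  move=> x; have [r r0 fin] := proper x; exists (r / 2); split.
    by rewrite divr_gt0.
  move=> y; have [[g0 hg0]|none] :=
    pselect (exists g0, mdist (act g0 x) y < r / 2); last first.
    suff -> : [set g | mdist (act g x) y < r / 2] = set0 by exact: finite_set0.
    by apply/seteqP; split=> // g hg; apply: none; exists g.
  apply: sub_finite_set (finite_image (fun h => (g0 * h)%g) fin) => g /= hg.
  exists (g0^-1 * g)%g; last by rewrite mulgA mulgV mul1g.
  exists (act (g0^-1 * g)%g x); split.
    by exists x => //; exact: ballxx.
  rewrite ballEmdist /= (act_mul isoact) metric_sym act_move invgK.
  have := metric_triangle (act g x) y (act g0 x).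
  by rewrite (metric_sym y); lra.
by exists r => [x|x y]; have [] := rP x.
Qed.

(** Cover K by finitely many balls.  If g moves a point of one ball near a point
    of another, then g brings the centre with the larger radius near the other
    centre, or g^-1 does. *)
Lemma finite_transporter (K : set Y) : compact K -> exists2 eta : R, 0 < eta &
  finite_set [set g | exists k k', [/\ K k, K k' & mdist (act g k) k' < eta]].
Proof.
move=> cK; have [r r0 fin] := finite_near_orbit.
have [|s sK] := @ball_cover_compact R Y K (fun x => r x / 4) cK.
  by move=> x; rewrite divr_gt0.
have [eta eta0 etas] : exists2 eta : R, 0 < eta &
    forall x, x \in s -> eta <= r x / 4.
  elim: s {sK} => [|x s [eta eta0 etas]]; first by exists 1.
  exists (Num.min eta (r x / 4)); first by rewrite lt_min eta0 divr_gt0.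
  move=> y; rewrite inE => /orP[/eqP ->|ys]; first by rewrite ge_min lexx orbT.
  by rewrite ge_min etas.
exists eta => //.
pose A (p : Y * Y) := [set g | mdist (act g p.1) p.2 < r p.1].
pose B := \bigcup_(p in [set` s] `*` [set` s]) A p.
have finB : finite_set B.
  by apply: bigcup_finite => [|p _]; [exact: finite_setX | exact: fin].
apply: (@sub_finite_set _ _ (B `|` [set g^-1%g | g in B])); last first.
  by rewrite finite_setU; split=> //; exact: finite_image.
move=> g [k [k' [Kk Kk' gkk']]].
have [x xs xk] := sK _ Kk; have [y ys yk'] := sK _ Kk'.
have ex := etas x xs; have ey := etas y ys.
have d1 := metric_triangle (act g x) (act g k) y.
have d2 := metric_triangle (act g k) k' y.
rewrite (act_isometry isoact) in d1; rewrite (metric_sym k') in d2.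
have [xy|yx] := leP (r y) (r x).
  by left; exists (x, y) => //; rewrite /A /=; lra.
right; exists g^-1%g; last exact: invgK.
exists (y, x) => //; rewrite /A /= act_move invgK metric_sym; lra.
Qed.

Hypothesis cocompact : cocompact_action act.
Hypothesis geoY : forall (x y : Y) (t : R), 0 <= t <= 1 ->
  exists m, at_fraction x y t m.

(** Walk from x to y in steps of length eta / 2.  Each step multiplies the
    element that brings K onto the current point by one of the finitely many
    elements of finite_transporter. *)
Lemma ball_covered_by_translates : exists2 K : set Y, compact K &
  forall x r, exists2 F : set G, finite_set F &
    forall y, mdist x y <= r -> exists2 a, F a & exists2 k, K k & y = act a k.
Proof.
have [K cK cover] := cocompact; exists K => //.
have rep y : exists g k, K k /\ y = act g k.
  have : (\bigcup_(g in [set: G]) (act g @` K)) y by rewrite cover.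
  by move=> [g _ [k Kk <-]]; exists g, k.
have [eta eta0 finT] := finite_transporter cK; set T := [set g | _] in finT.
have chain n : exists2 F : set G, finite_set F & forall x y, K x ->
    mdist x y <= n%:R * (eta / 2) ->
    exists2 a, F a & exists2 k, K k & y = act a k.
  elim: n => [|n [F finF FP]].
    exists [set 1%g]; first exact: finite_set1.
    move=> x y Kx; rewrite mul0r => xy0; exists 1%g => //; exists x => //.
    rewrite act_one //; apply/esym/mdist_positivity/eqP.
    by rewrite eq_le xy0 mdist_ge0.
  exists [set (a * b)%g | a in F & b in T]; first exact: finite_image2.
  move=> x y Kx xy; pose t : R := n%:R / n.+1%:R.
  have n0 : 0 < n.+1%:R :> R by rewrite ltr0Sn.
  have tn : t * n.+1%:R = n%:R by rewrite divfK // gt_eqF.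
  have t01 : 0 <= t <= 1.
    by rewrite divr_ge0 //= ler_pdivrMr // mul1r ler_nat.
  have [m [xm my]] := geoY x y t01; have /andP[t0 t1] := t01.
  have [|a Fa [k Kk mk]] := FP x m Kx.
    by rewrite xm -tn -mulrA ler_wpM2l.
  have my2 : mdist m y < eta.
    rewrite my; apply: le_lt_trans (ler_wpM2l _ xy) _; first by rewrite subr_ge0.
    have -> : (1 - t) * (n.+1%:R * (eta / 2)) =
      (n.+1%:R - t * n.+1%:R) * (eta / 2) by ring.
    rewrite tn -natr1; move: (n%:R : R) => q; lra.
  have [b [k' [Kk' yk']]] := rep (act a^-1%g y).
  exists (a * b)%g; last first.
    by exists k' => //; rewrite (act_mul isoact) -yk' actKV.
  exists a => //; exists b => //; exists k', k; split=> //.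
  by rewrite -yk' -(actV a k) (act_isometry isoact) -mk metric_sym.
move=> x r; have [g0 [k0 [Kk0 ->]]] := rep x.
pose n := Num.truncn (2 * r / eta).
have [F finF FP] := chain n.+1.
exists [set (g0 * a)%g | a in F]; first exact: finite_image.
move=> y; rewrite act_move => h.
have [|a Fa [k Kk yk]] := FP k0 _ Kk0 (le_trans h _).
  have : 2 * r / eta < n.+1%:R by exact: truncnS_gt.
  by rewrite ltr_pdivrMr // => /ltW; lra.
exists (g0 * a)%g; first by exists a.
by exists k => //; rewrite (act_mul isoact) -yk actKV.
Qed.

Lemma act_continuous (g : G) : continuous (act g).
Proof.
move=> y; apply/metricType_numDomainType.cvgrPdist_le => e e0; near=> z.
rewrite (act_isometry isoact); near: z.
exact: (@metricType_numDomainType.cvgr_dist_le _ _ _ (nbhs y) _ id y).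
Unshelve. all: by end_near. Qed.

Lemma proper_space : balls_in_compacts Y.
Proof.
move=> x r; have [K cK KP] := ball_covered_by_translates.
have [F finF FP] := KP x r; have /finite_seqP[s sF] := finF.
exists (\big[setU/set0]_(a <- s) (act a @` K)).
  apply: bigsetU_compact => a _; apply: continuous_compact => //.
  by apply: continuous_subspaceT; exact: act_continuous.
move=> y /FP[a Fa [k Kk ->]]; rewrite -bigcup_seq.
by exists a; [rewrite sF in Fa; rewrite /= Fa | exists k].
Qed.

Lemma finite_orbit_ball (x : Y) (r : R) :
  finite_set [set g | mdist x (act g x) <= r].
Proof.
have [K cK KP] := ball_covered_by_translates.
have [F finF FP] := KP x r; have [F0 _ FP0] := KP x 0.
have [|a0 _ [k0 Kk0 xk0]] := FP0 x; first by rewrite mdistxx.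
have [eta eta0 finT] := finite_transporter cK; set T := [set g | _] in finT.
apply: (@sub_finite_set _ _
  [set (c * a0^-1)%g | c in [set (a * b)%g | a in F & b in T]]); last first.
  by apply: finite_image; exact: finite_image2.
move=> g /FP[a Fa [k Kk gxk]].
exists (g * a0)%g; last by rewrite mulgK.
exists a => //; exists (a^-1 * (g * a0))%g; last by rewrite mulgA mulgV mul1g.
exists k0, k; split=> //.
by rewrite !(act_mul isoact) -xk0 gxk actV mdistxx.
Qed.

End ProperCocompact.

(** * Translates of the axis and bounded packing *)

Section Axis.
Variables (R : realType) (G : groupType) (Y : metricType R) (act : G -> Y -> Y).
Variables (g : G) (l : R -> Y) (tau : R).
Hypothesis isoact : isometric_action act.
Hypothesis tau0 : 0 < tau.
Hypothesis axis : forall t, act g (l t) = l (t + tau).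

Lemma act_expg (n : nat) (t : R) : act (g ^+ n)%g (l t) = l (t + n%:R * tau).
Proof.
elim: n t => [|n IH] t; first by rewrite expg0 act_one // mul0r addr0.
by rewrite expgSr (act_mul isoact) axis IH -natr1; congr l; ring.
Qed.

Lemma act_expgV (n : nat) (t : R) : act (g ^- n)%g (l t) = l (t - n%:R * tau).
Proof. by rewrite -[t in LHS](subrK (n%:R * tau)) -act_expg actV. Qed.

Lemma axis_shift (r : R) : exists h a,
  [/\ cyclic_subgroup g h, forall t, act h (l t) = l (t + a) & 0 <= r + a <= tau].
Proof.
pose k := Num.floor (r / tau).
have /andP[k1 k2] : k%:~R <= r / tau < (k + 1)%:~R by rewrite floor_itv // num_real.
rewrite ler_pdivlMr // in k1; rewrite ltr_pdivrMr // intrD mulrDl mul1r in k2.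
case: k k1 k2 => n k1 k2.
  exists (g ^- n)%g, (- (n%:R * tau)); split.
  - by exists n; right.
  - by move=> t; rewrite act_expgV.
  - by rewrite -pmulrn in k1 k2; lra.
exists (g ^+ n.+1)%g, (n.+1%:R * tau); split.
- by exists n.+1; left.
- by move=> t; rewrite act_expg.
- by rewrite NegzE rmorphN /= -pmulrn mulNr in k1 k2; lra.
Qed.

Lemma axis_recurrent : recurrent_line l tau.
Proof.
move=> r; have [h [a [_ hl ra]]] := axis_shift r.
by exists (act h), a; split=> // y z; rewrite (act_isometry isoact).
Qed.

Lemma cyclic_shift (h : G) : cyclic_subgroup g h -> exists a, act h (l 0) = l a.
Proof.
move=> [n [->|->]]; eexists; [exact: act_expg | exact: act_expgV].
Qed.

End Axis.

Section CommonPoint.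
Variables (R : realType) (G : groupType) (Y : metricType R) (act : G -> Y -> Y).
Variable (l : R -> Y).
Hypothesis cnY : CN_space Y.
Hypothesis isoact : isometric_action act.
Hypothesis line_l : geodesic_line l.

(** Choose z so that the largest of its distances to the lines is minimal up to
    1.  If this value N is large, some line is at distance more than N - 1, and
    by lines_approach the projection of z on it is within 3 / 4 N + K of all the
    lines, which contradicts the choice of z. *)
Lemma common_point (S0 L e C : R) :
  0 < S0 -> 0 < L -> 0 < e -> expanding l S0 L e ->
  exists2 r : R, 0 <= r & forall (I : Type) (a : I -> G),
    (forall i j, exists s t, mdist (act (a i) (l s)) (act (a j) (l t)) <= C) ->
    (exists z M, forall i, height l (act (a i)^-1%g z) <= M) ->
    exists z, forall i, height l (act (a i)^-1%g z) <= r.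
Proof.
move=> S00 L0 e0 exp; have K0 : 0 <= 18 :> R by [].
have [S + drift] := slow_drift_exists cnY line_l (Num.max C 0) S00 L0 e0 exp K0.
rewrite ge_max => /andP[CS S_ge0].
pose K := 4 * S + 4 + 3 * L; have K4 : 0 <= K by rewrite /K; lra.
exists (4 * K + 8) => [|I a close [z0 [M hM]]]; first lra.
pose P n := `[< exists z, forall i, height l (act (a i)^-1%g z) <= n%:R >].
have exP : exists n, P n.
  exists (Num.truncn M).+1; apply/asboolP; exists z0 => i.
  by apply: le_trans (hM i) _; apply/ltW; exact: truncnS_gt.
case: (ex_minnP exP) => N /asboolP[z hz] Nmin.
have [Nsmall|Nbig] := leP (N%:R : R) (4 * K + 8).
  by exists z => i; apply: le_trans (hz i) Nsmall.
case: N hz Nmin Nbig => [|N] hz Nmin Nbig; first by move: Nbig; rewrite /=; lra.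
rewrite -natr1 in hz Nbig.
have [i hi] : exists i, N%:R < height l (act (a i)^-1%g z).
  apply: contrapT => none; have /Nmin : P N; last by rewrite ltnn.
  apply/asboolP; exists z => i; rewrite leNgt; apply/negP => h.
  by apply: none; exists i.
suff /Nmin : P N by rewrite ltnn.
apply/asboolP; exists (act (a i) (l (foot l (act (a i)^-1%g z)))) => j.
pose l' t := act (a i)^-1%g (act (a j) (l t)).
have line' : geodesic_line l'.
  by move=> s t _ _; rewrite /l' !(act_isometry isoact) line_l.
have [s [t st]] := close i j.
have [|||u hu] := @lines_approach R Y l cnY line_l L S C (N%:R + 1)
    (foot l (act (a j)^-1%g z)) t l' (act (a i)^-1%g z) L0 S_ge0 CS drift line'.
- by rewrite hz andbT addrK ltW.
- rewrite /l' (act_isometry isoact) metric_sym (act_move isoact) metric_sym.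
  exact: hz.
- apply: le_trans (height_le line_l _ s) _.
  by rewrite /l' metric_sym -(act_move isoact).
apply: le_trans (height_le line_l _ u) _.
rewrite metric_sym -(act_move isoact) metric_sym (act_move isoact).
by apply: le_trans hu _; rewrite -/K; lra.
Qed.

End CommonPoint.

(** The orbit map of y has finite fibres; the discrete metric separates their
    points. *)
Lemma orbit_metric (R : realType) (G : groupType) (Y : metricType R)
    (act : G -> Y -> Y) (y : Y) : isometric_action act ->
  (forall r : R, finite_set [set g | mdist y (act g y) <= r]) ->
  exists d : G -> G -> R, proper_left_invariant_metric d.
Proof.
move=> isoact fin.
exists (fun g h => mdist (act g y) (act h y) + (g != h)%:R); split.
- by move=> g h; rewrite addr_ge0 // mdist_ge0.
- move=> g h; split=> [/eqP|->]; last by rewrite mdistxx eqxx addr0.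
  rewrite paddr_eq0 ?mdist_ge0 // => /andP[_].
  by rewrite pnatr_eq0 eqb0 negbK => /eqP.
- by move=> g h; rewrite metric_sym eq_sym.
- move=> g h k; rewrite addrACA lerD // ?metric_triangle //.
  rewrite -natrD ler_nat; have [->|gh] := eqVneq g h; first by rewrite add0n.
  by case: (g != k); rewrite //= add1n.
- move=> k g h; rewrite !(act_mul isoact) (act_isometry isoact).
  by rewrite (inj_eq (@mulgI _ k)).
- move=> g r; apply: sub_finite_set (finite_image (fun h => (g * h)%g) (fin r)).
  move=> h /= ghr; exists (g^-1 * h)%g; last by rewrite mulgA mulgV mul1g.
  rewrite /= (act_mul isoact) -(act_move isoact).
  by apply: le_trans ghr; rewrite lerDl.
Qed.

Lemma card_gt_injection (T : pointedType) (I : set T) (n : nat) :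
  ~ (I #<= `I_n)%card ->
  exists f : nat -> T, {in `I_n.+1 &, injective f} /\
    forall i, (i < n.+1)%N -> I (f i).
Proof.
move=> In; have /pcard_leP[f] : (`I_n.+1 #<= I)%card.
  have [/finite_setP[m Im]|/infiniteP infI] := pselect (finite_set I); last first.
    exact: card_le_trans (card_leT _) infI.
  rewrite (card_le_eqr Im) card_le_II ltnNge; apply/negP => mn; apply: In.
  by rewrite (card_le_eql Im) card_le_II.
exists f; split; first exact: inj.
by move=> i hi; exact: funS.
Qed.

Lemma cyclic_subgroup_div (G : groupType) (g h k : G) :
  cyclic_subgroup g h -> cyclic_subgroup g k -> cyclic_subgroup g (h^-1 * k)%g.
Proof.
have VX m n : cyclic_subgroup g (g ^- m * g ^+ n)%g.
  case: (leqP m n) => mn; [exists (n - m)%N; left|exists (m - n)%N; right].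
    by rewrite -{1}(subnKC mn) expgnDr mulKg.
  by rewrite -{1}(subnKC (ltnW mn)) expgnDr invgM mulgVK.
have XV m n : cyclic_subgroup g (g ^+ m * g ^- n)%g.
  case: (leqP n m) => mn; [exists (m - n)%N; left|exists (n - m)%N; right].
    by rewrite -{1}(subnK mn) expgnDr mulgK.
  by rewrite -{1}(subnK (ltnW mn)) expgnDr invgM mulVKg.
move=> [m [->|->]] [n [->|->]]; rewrite ?invgK.
- exact: VX.
- by exists (n + m)%N; right; rewrite expgnDr invgM.
- by exists (m + n)%N; left; rewrite expgnDr.
- exact: XV.
Qed.

Lemma coset_eq (G : groupType) (g a b x : G) :
  let H := cyclic_subgroup g in
  [set (a * h)%g | h in H] x -> [set (b * h)%g | h in H] x ->
  [set (a * h)%g | h in H] `<=` [set (b * h)%g | h in H].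
Proof.
move=> H [h Hh hx] [k Hk kx] y [u Hu <-].
have H1 : H 1%g by exists 0%N; left; rewrite expg0.
have Hinv v : H v -> H v^-1%g.
  by move=> Hv; rewrite -[v^-1%g]mulg1; exact: cyclic_subgroup_div.
have Hmul v w : H v -> H w -> H (v * w)%g.
  by move=> /Hinv Hv Hw; rewrite -[v]invgK; exact: cyclic_subgroup_div.
exists (k * (h^-1 * u))%g; first by apply: Hmul => //; exact: cyclic_subgroup_div.
by rewrite mulgA kx -hx -mulgA mulVKg.
Qed.

Theorem theorem4p1 (R : realType) (G : groupType) (Y : metricType R)
    (act : G -> Y -> Y) (g : G) :
  CAT0 Y ->
  isometric_action act ->
  proper_action act ->
  cocompact_action act ->
  rank_one (act g) ->
  bounded_packing R (cyclic_subgroup g).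
Proof.
move=> cat0 isoact proper cocompact [l [line_l [tau tau0 axis]] noflat].
have cnY := CAT0_CN cat0.
have geoY := at_fraction_exists cnY.
have finorb := finite_orbit_ball isoact proper cocompact geoY (l 0).
split; first exact: orbit_metric isoact finorb.
have properY := proper_space isoact proper cocompact geoY.
have [S0 [L [e [S00 L0 e0 exp]]]] := expansion cnY line_l properY
  (axis_recurrent isoact tau0 axis) noflat.
move=> d dP D D0.
have [C C0 hC] := finite_set_ubound (fun h => mdist (l 0) (act h (l 0)))
  (plim_proper dP 1%g (D + 1)).
have [r r0 common] := common_point cnY isoact line_l C S00 L0 e0 exp.
have /finite_set_leP[n nE] := finorb (2 * (r + tau)).
exists n => I Icosets Iclose; apply: contrapT => /card_gt_injection[A [Ainj IA]].
have /choice[a aP] : forall i : 'I_n.+1, exists a : G,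
    A i = [set (a * h)%g | h in cyclic_subgroup g].
  by move=> i; have [a _ <-] := Icosets _ (IA i (ltn_ord i)); exists a.
have sub1 : cyclic_subgroup g 1%g by exists 0%N; left; rewrite expg0.
(* A pair of elements within D + 1 differs by one of finitely many elements,
   which move l 0 by at most C. *)
have close i j : exists s t, mdist (act (a i) (l s)) (act (a j) (l t)) <= C.
  have := Iclose _ _ (IA i (ltn_ord i)) (IA j (ltn_ord j)).
  rewrite /set_dist; set E := [set _ | _ in _ & _ in _] => ED.
  have [||x [s As [t At <-]] xD] := @inf_adherent R E 1.
  - exact: ltr01.
  - split; first by exists (d (a i) (a j)); rewrite /E !aP; exists (a i);
      [|exists (a j)] => //; exists 1%g => //; rewrite mulg1.
    by exists 0 => x [s _ [t _ <-]]; exact: (plim_ge0 dP).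
  rewrite aP /= in As; rewrite aP /= in At.
  have [h hH hs] := As; have [k kH kt] := At.
  have [u hu] := cyclic_shift isoact axis hH.
  have [v kv] := cyclic_shift isoact axis kH.
  exists u, v; rewrite -hu -kv -!(act_mul isoact) hs kt.
  have := hC (s^-1 * t)%g; rewrite (act_mul isoact) -(act_move isoact); apply.
  rewrite /= -(plim_left_invariant dP s) mulg1 mulgA mulgV mul1g.
  by apply: ltW; apply: lt_le_trans xD _; rewrite lerD2r.
have [|z hz] := common _ a close.
  exists (l 0), (\sum_(i < n.+1) height l (act (a i)^-1%g (l 0))) => i.
  rewrite (bigD1 i) //= lerDl sumr_ge0 // => j _; exact: height_ge0.
(* The representative of each coset is moved along its line to the element
   whose orbit point is nearest to the common point z. *)
have /choice[b bP] : forall i : 'I_n.+1, exists b : G,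
    A i b /\ mdist z (act b (l 0)) <= r + tau.
  move=> i; pose p := foot l (act (a i)^-1%g z).
  have [h [c [hH hl]]] := axis_shift isoact tau0 axis (- p).
  exists (a i * h)%g; split; first by rewrite aP; exists h.
  rewrite (act_mul isoact) hl add0r metric_sym (act_move isoact).
  apply: le_trans (metric_triangle _ (l p) _) _; rewrite addrC lerD //.
    by rewrite metric_sym; exact: hz.
  by rewrite (lineE line_l) ger0_norm; lra.
have bE i : mdist (l 0) (act ((b ord0)^-1 * b i)%g (l 0)) <= 2 * (r + tau).
  rewrite (act_mul isoact) -(act_move isoact).
  have := metric_triangle (act (b ord0) (l 0)) z (act (b i) (l 0)).
  have := (bP i).2; have := (bP ord0).2.
  rewrite (metric_sym (act (b ord0) (l 0)) z); lra.
have binj i j : b i = b j -> i = j.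
  move=> bij; apply/val_inj/Ainj; rewrite ?inE ?ltn_ord //=.
  have [bi _] := bP i; have [bj _] := bP j; rewrite -bij in bj.
  rewrite aP in bi *; rewrite aP in bj *.
  by apply/seteqP; split; [exact: coset_eq bi bj|exact: coset_eq bj bi].
pose psi k := ((b ord0)^-1 * b (inord k))%g.
have psi_inj : {in `I_n.+1 &, injective psi}.
  move=> i j; rewrite !inE /= => ni nj /mulgI/binj ij.
  by rewrite -(inordK ni) -(inordK nj) ij.
suff : (`I_n.+1 #<= `I_n)%card by rewrite card_le_II ltnn.
apply: card_le_trans nE; rewrite -(card_le_eql (inj_card_eq psi_inj)).
apply: subset_card_le => _ [k _ <-]; exact: bE.
Qed.
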